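(* Let $N\ge 3$ and let $\Gamma_1,\dots,\Gamma_N\in\mathbb{R}\setminus\{0\}$ with $\Gamma=\sum_{i=1}^N\Gamma_i\neq 0$. Let $\mu_0\in F^{-1}(0)=\mathring{\mathfrak v}_{\mathcal K}^{(1)}$ be a fixed point of the Lie–Poisson dynamics $\dot\mu=X_h(\mu)$. Let $\{C_{j_1},\dots,C_{j_K}\}$ be a subset (with $K$ distinct indices) of the Casimirs $\{C_j\}_{j=1}^{N-1}$ such that the functions $$\{C_{j_k}\}_{k=1}^{K}\ \cup\ \{F_i\}_{i=1}^{N-2}\ \cup\ \{\operatorname{Re}F_{ij},\operatorname{Im}F_{ij}\}_{1\le i<j\le N-2}$$ are independent at $\mu_0$, in the sense that their exterior differentials at $\mu_0$ are linearly independent. Suppose that there exist $a_0\in\mathbb{R}\setminus\{0\}$, $a_1,\dots,a_K\in\mathbb{R}$, $b_1,\dots,b_{N-2}\in\mathbb{R}$ and $(c_{ij},d_{ij})\in\mathbb{R}^2$ for $1\le i<j\le N-2$ such that the function $$f(\mu)= a_0h(\mu)+\sum_{k=1}^{K}a_kC_{j_k}(\mu)+\sum_{i=1}^{N-2}b_iF_i(\mu)+\sum_{1\le i<j\le N-2}\bigl(c_{ij}\operatorname{Re}F_{ij}(\mu)+d_{ij}\operatorname{Im}F_{ij}(\mu)\bigr)$$ satisfies: (i) $Df(\mu_0)=0$; and (ii) the Hessian $\mathsf H=D^2f(\mu_0)$ is positive definite on the tangent space at $\mu_0$ of the submanifold $$M=\{\mu\in\mathring{\mathfrak v}_{\mathcal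 K}\mid F(\mu)=0,\ C_{j_k}(\mu)=C_{j_k}(\mu_0)\ \text{for all }k\in\{1,\dots,K\}\},$$ i.e. $v^T\mathsf Hv>0$ for every $v\in (T_{\mu_0}M)\setminus\{0\}\subset\mathbb{R}^{(N-1)^2}$. Then $\mu_0$ is Lyapunov stable to perturbations that preserve $F^{-1}(0)$.
   Context: **Vector space.** $\mathfrak v_{\mathcal K}=\{\mu\in\mathbb{C}^{(N-1)\times(N-1)}\mid \mu^*=-\mu\}$, regarded as a real vector space with inner product $\langle\xi,\eta\rangle=\tfrac12\operatorname{tr}(\xi^*\eta)$, which identifies it with its dual. Each $\mu\in\mathfrak v_{\mathcal K}$ is written $\mu=\mathrm{i}\,A$, where $A$ is the Hermitian matrix with diagonal entries $\mu_1,\dots,\mu_{N-1}\in\mathbb{R}$ and upper off-diagonal entries $\mu_{ij}\in\mathbb{C}$ for $1\le i<j\le N-1$. The real numbers $\mu_i$, $\operatorname{Re}\mu_{ij}$, $\operatorname{Im}\mu_{ij}$ are coordinates identifying $\mathfrak v_{\mathcal K}$ with $\mathbb{R}^{(N-1)^2}$; $D$ and $D^2$ are taken in these coordinates. **Matrix $\mathcal K$.** $\mathcal K$ is the real symmetric $(N-1)\times(N-1)$ matrix with $\mathcal K_{ii}=-\Gamma_i(\Gamma-\Gamma_i)/\Gamma$ and $\mathcal K_{ij}=\Gamma_i\Gamma_j/\Gamma$ for $i\ne j$; it is invertible. **Hamiltonian.** $$h(\mu)=-\frac1{4\pi}\Bigl(\Gamma_N\sum_{i=1}^{N-1}\Gamma_i\ln\mu_i+\sum_{1\le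 i<j\le N-1}\Gamma_i\Gamma_j\ln(\mu_i+\mu_j-2\operatorname{Re}\mu_{ij})\Bigr),$$ defined on the open set where all arguments of the logarithms are positive (no collisions of vortices). The dynamics is considered on this open set; in particular the fixed point $\mu_0$ lies in it. **Dynamics.** The derivative $\delta h/\delta\mu\in\mathfrak v_{\mathcal K}$ is defined by $\langle\nu,\delta h/\delta\mu\rangle=\frac{d}{ds}\big|_{s=0}h(\mu+s\nu)$ for all $\nu\in\mathfrak v_{\mathcal K}$. The Lie–Poisson dynamics is $$\dot\mu=X_h(\mu)=-\mu\,\frac{\delta h}{\delta\mu}\,\mathcal K^{-1}+\mathcal K^{-1}\,\frac{\delta h}{\delta\mu}\,\mu .$$ A fixed point is a $\mu_0$ with $X_h(\mu_0)=0$. **Casimirs.** $C_j(\mu)=\operatorname{tr}((\mathrm{i}\,\mathcal K\mu)^j)$, $j\in\mathbb{N}$; these are real-valued and conserved by the dynamics. **Constraint functions.** $\mathring{\mathfrak v}_{\mathcal K}$ is the open subset of $\mu\in\mathfrak v_{\mathcal K}$ with all $\mu_i\ne0$ ($1\le i\le N-1$) and all $\mu_{ij}\neq0$ ($1\le i<j\le N-1$); $\mathring{\mathfrak v}_{\mathcal K}^{(1)}$ is the set of $\mu\in\mathring{\mathfrak v}_{\mathcal K}$ of rank $1$. On $\mathring{\mathfrak v}_{\mathcal K}$ define, with the convention $\mu_{ii}=\mu_i$, $$F_i(\mu)=\mu_i\mu_{i+1}-|\mu_{i,i+1}|^2\in\mathbb{R}\quad(1\le i\le N-2),$$ $$F_{ij}(\mu)=\mu_{i,j}\,\mu_{i+1,j+1}-\mu_{i,j+1}\,\mu_{i+1,j}\in\mathbb{C}\quad(1\le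 i<j\le N-2),$$ and let $F:\mathring{\mathfrak v}_{\mathcal K}\to\mathbb{R}^{N-2}\times\mathbb{C}^{\binom{N-2}{2}}\cong\mathbb{R}^{(N-2)^2}$ be the map with components all $F_i$ and all $F_{ij}$. One has $F^{-1}(0)=\mathring{\mathfrak v}_{\mathcal K}^{(1)}$; it is a submanifold, and it is invariant under the dynamics. **Stability.** $\mu_0\in F^{-1}(0)$ is Lyapunov stable to perturbations that preserve $F^{-1}(0)$ if for every neighborhood $U$ of $\mu_0$ in $F^{-1}(0)$ there is a neighborhood $V\subset U$ of $\mu_0$ in $F^{-1}(0)$ such that every solution with $\mu(0)\in V$ satisfies $\mu(t)\in U$ for all $t\ge0$. *)

(* Defs.v *)
From HB Require Import structures.
From mathcomp Require Import all_boot all_order all_algebra.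
From mathcomp Require Import complex.
From mathcomp Require Import all_classical all_reals all_analysis.

Set Implicit Arguments.
Unset Strict Implicit.
Unset Printing Implicit Defensive.

Import Order.TTheory GRing.Theory Num.Theory.
Import numFieldNormedType.Exports.

Local Open Scope classical_set_scope.
Local Open Scope ring_scope.
Local Open Scope complex_scope.

Local Notation Re := complex.Re.
Local Notation Im := complex.Im.

(* There are N = n.+3 vortices, so N - 1 = n.+2 and N - 2 = n.+1.  Indices are
   0-based: vortex N is [ord_max : 'I_n.+3], and the vortices 1, .., N - 1 are
   the images of 'I_n.+2 under [widen_ord]. *)

Section LiePoisson.
Variables (R : realType) (n : nat).

(* The coordinate space R^((N-1)^2) of v_K: for x in it, [x i i] is mu_i and,
   for i < j, [x i j] is Re mu_ij and [x j i] is Im mu_ij. *)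
Definition coords := 'M[R]_n.+2.

Definition herm (x : coords) : 'M[R[i]]_n.+2 :=
  \matrix_(i, j) if (i < j)%N then x i j +i* x j i
                 else if (j < i)%N then x j i -i* x i j
                 else (x i i)%:C.

Definition vK_mx (x : coords) : 'M[R[i]]_n.+2 := 'i *: herm x.

Definition adjmx (M : 'M[R[i]]_n.+2) : 'M[R[i]]_n.+2 := map_mx conjc M^T.

Definition vK : set 'M[R[i]]_n.+2 := [set M | adjmx M = - M].

Lemma vK_mx_bij : set_bij setT vK vK_mx.
Proof.
have iu : ('i : R[i]) != 0 by rewrite eq_complex /= oner_eq0 andbF.
split.
- move=> x _; rewrite /vK /=; apply/matrixP => i j; rewrite !mxE.
  by case: (ltngtP i j) => [ij|ji|/val_inj ->]; simpc.
- move=> x y _ _ /(scalerI iu)/matrixP xy.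
  apply/matrixP => i j.
  have := xy i j; have := xy j i; rewrite !mxE.
  by case: (ltngtP i j) => [ij|ji|/val_inj ->] // [] // => [-> _|-> _] [].
- move=> M /= MK; have H k l : conjc (M l k) = - M k l.
    by move/matrixP: MK => /(_ k l); rewrite !mxE.
  exists (\matrix_(i, j) if (i <= j)%N then Im (M i j)
                         else - Re (M j i)) => //.
  apply/matrixP => i j; rewrite !mxE.
  have {H} := H i j.
  case: (ltngtP i j) => [ij|ji|/val_inj <-].
  + by case: (M i j) => a b _; simpc.
  + by case: (M i j) (M j i) => [a b] [c d] [-> /oppr_inj ->]; simpc.
  + rewrite leqnn; case: (M i i) => a b [/eqP]; rewrite -addr_eq0.
    by rewrite -mulr2n mulrn_eq0 /= => /eqP ->; simpc.
Qed.

(* The trace is real when xi, eta are in vK; likewise for [casimir] below. *)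
Definition vK_inner (xi eta : 'M[R[i]]_n.+2) : R :=
  2%:R^-1 * Re (\tr (adjmx xi *m eta)).

Section Dynamics.
Variable Gam : 'I_n.+3 -> R.

Definition Gtot : R := \sum_i Gam i.

Definition Gm (i : 'I_n.+2) : R := Gam (widen_ord (leqnSn _) i).

Definition Kmx : 'M[R]_n.+2 :=
  \matrix_(i, j) if i == j then - Gm i * (Gtot - Gm i) / Gtot
                 else Gm i * Gm j / Gtot.

Definition KmxC : 'M[R[i]]_n.+2 := map_mx (real_complex R) Kmx.

Definition diagc (x : coords) (i : 'I_n.+2) : R := Re (herm x i i).

Definition pairc (x : coords) (i j : 'I_n.+2) : R :=
  diagc x i + diagc x j - 2%:R * Re (herm x i j).

Definition dom : set coords :=
  [set x | (forall i, 0 < diagc x i) /\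
           (forall i j : 'I_n.+2, (i < j)%N -> 0 < pairc x i j)].

Definition ham (x : coords) : R :=
  - (4%:R * pi)^-1 *
  (Gam ord_max * (\sum_i Gm i * ln (diagc x i)) +
   \sum_(i < n.+2) \sum_(j < n.+2 | (i < j)%N) Gm i * Gm j * ln (pairc x i j)).

(* The unique element of v_K representing the derivative of [ham] at [x]; the
   directions nu in v_K are parametrized by their coordinates. *)
Definition dham (x : coords) : 'M[R[i]]_n.+2 :=
  xget 0 [set G | vK G /\
    forall v : coords, vK_inner (vK_mx v) G = 'D_v ham x].

Definition X_h (x : coords) : 'M[R[i]]_n.+2 :=
  - vK_mx x *m dham x *m invmx KmxC + invmx KmxC *m dham x *m vK_mx x.

(* [x] is a solution on [0, T[, with T = +oo allowed.  As [vK_mx] is linear,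
   [vK_mx (derive1 x t)] is the time derivative of the matrix [vK_mx (x t)]. *)
Definition solution (T : \bar R) (x : R -> coords) :=
  let J := [set t : R | 0 <= t /\ (t%:E < T)%E] in
  [/\ {within J, continuous x},
      forall t, J t -> dom (x t) &
      forall t, J t -> 0 < t ->
        derivable x t 1 /\ vK_mx (derive1 x t) = X_h (x t)].

Definition casimir (j : nat) (x : coords) : R :=
  Re (\tr (('i *: (KmxC *m vK_mx x)) ^+ j)).

Definition lo (i : 'I_n.+1) : 'I_n.+2 := widen_ord (leqnSn _) i.
Definition hi (i : 'I_n.+1) : 'I_n.+2 := lift ord0 i.

(* The pairs i < j in {1, .., N - 2}. *)
Definition upair := {p : 'I_n.+1 * 'I_n.+1 | (p.1 < p.2)%N}.

Definition Fd (i : 'I_n.+1) (x : coords) : R :=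
  diagc x (lo i) * diagc x (hi i) - Re (`|herm x (lo i) (hi i)| ^+ 2).

Definition Fo (p : upair) (x : coords) : R[i] :=
  let: (i, j) := val p in
  herm x (lo i) (lo j) * herm x (hi i) (hi j)
  - herm x (lo i) (hi j) * herm x (hi i) (lo j).

Definition ringv : set coords :=
  [set x | (forall i, diagc x i != 0) /\
           (forall i j : 'I_n.+2, (i < j)%N -> herm x i j != 0)].

Definition Fzero : set coords :=
  [set x | [/\ ringv x, forall i, Fd i x = 0 & forall p, Fo p x = 0]].

Definition lyapunov_stable_on_Fzero (x0 : coords) :=
  forall U : set coords, U `<=` Fzero -> within Fzero (nbhs x0) U ->
  exists V : set coords,
    [/\ V `<=` U, within Fzero (nbhs x0) V &
        forall (T : \bar R) (x : R -> coords), (0 < T)%E -> solution T x ->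
          V (x 0) -> forall t : R, 0 <= t -> (t%:E < T)%E -> U (x t)].

Section Constraints.
Variables (K : nat) (j : 'I_K -> nat).

Definition constraint (s : 'I_K + ('I_n.+1 + (upair + upair))) :
    coords -> R :=
  match s with
  | inl k => casimir (j k)
  | inr (inl i) => Fd i
  | inr (inr (inl p)) => fun x => Re (Fo p x)
  | inr (inr (inr p)) => fun x => Im (Fo p x)
  end.

Definition Mset (x0 : coords) : set coords :=
  [set x | Fzero x /\ forall k, casimir (j k) x = casimir (j k) x0].

Definition lyapf (a0 : R) (a : 'I_K -> R) (b : 'I_n.+1 -> R)
    (c d : upair -> R) (x : coords) : R :=
  a0 * ham x + \sum_k a k * casimir (j k) x + \sum_i b i * Fd i x
  + \sum_p (c p * Re (Fo p x) + d p * Im (Fo p x)).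

End Constraints.
End Dynamics.

Definition independent_at (I : finType) (g : I -> coords -> R) (x : coords) :=
  forall l : I -> R, (forall v : coords, \sum_s l s * 'd (g s) x v = 0) ->
  forall s, l s = 0.

(* Velocities at [x] of C^1 curves in [M] through [x]. *)
Definition tangent (M : set coords) (x : coords) : set coords :=
  [set v | exists (e : R) (g : R -> coords),
     [/\ 0 < e, g 0 = x,
         forall t, `|t| < e ->
           [/\ M (g t), derivable g t 1 & {for t, continuous (derive1 g)}] &
         derive1 g 0 = v]].

Definition partial (p : 'I_n.+2 * 'I_n.+2) (f : coords -> R) (x : coords) : R :=
  'D_(delta_mx p.1 p.2 : coords) f x.

Definition hessian (f : coords -> R) (x : coords)
    (p q : 'I_n.+2 * 'I_n.+2) : R := partial q (partial p f) x.

(* v^T H v *)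
Definition hess_quad (f : coords -> R) (x v : coords) : R :=
  \sum_p \sum_q v p.1 p.2 * hessian f x p q * v q.1 q.2.

End LiePoisson.

(* Main.v *)
(* All 2x2 minors of the Hermitian matrix vanish on F^{-1}(0), so
   there C_j = (C_1)^j.  Along solutions h and C_1 are constant and the minors stay
   zero (Gronwall), hence f is constant on solutions in F^{-1}(0).

   Every v annihilated by the differentials of C_1 and of the minors at
   mu_0 = s u u^H has the form s (u w^H + w u^H), and it is the velocity of the
   explicit rational curve s z(t) z(t)^H obtained by projecting the quadric
   z^H K z = u^H K u stereographically; so the Hessian is positive definite on
   that joint kernel.

   A Taylor expansion and compactness of the unit sphere then give e > 0 such
   that every point of F^{-1}(0) on a small sphere |mu - mu_0| = rho satisfies
   f(mu) - f(mu_0) >= e rho^2 or |C_1(mu) - C_1(mu_0)| >= e rho.  A solution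
   starting in F^{-1}(0) closer to mu_0, with smaller values of both conserved
   differences, can therefore never reach that sphere. *)
Require Import Defs.
From mathcomp Require Import all_boot all_order all_algebra.
From mathcomp Require Import complex.
From mathcomp Require Import ring lra.
From mathcomp Require Import all_classical all_reals all_analysis.

Set Implicit Arguments.
Unset Strict Implicit.
Unset Printing Implicit Defensive.

Import Order.TTheory GRing.Theory Num.Theory.
Import numFieldNormedType.Exports.

Local Open Scope classical_set_scope.
Local Open Scope ring_scope.

(** Tangent vectors of [Mset] are velocities of C^1 curves, so the Hessian hypothesis applies only
    to directions along which a curve is at hand; this is why the curves are explicit. Since C_j =
    C_1^j on F^{-1}(0), a rank-one curve with C_1 constant stays on the level of every C_j,
    whichever indices were selected.

    Nearby solutions may lie on other levels of C_1, where f - f(mu_0) need not be positive. Hence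
    the barrier has two alternatives and is not a strict minimum of f.

    Gronwall needs a bound on dh, and none holds uniformly near collisions. The bound is available
    in a small ball, so conservation is known only while the solution stays there, which is what has
    to be proved. The first time on the sphere of radius rho breaks the circle: up to that time the
    solution is in the closed ball, so the conserved quantities still have their initial values at
    the point where the barrier is applied. *)

(** * Second-order differentiability and Taylor expansion *)

Section SecondOrder.
Variables (R : realType) (n : nat).
Local Notation V := (coords R n).
Implicit Types (f g : V -> R) (x y v : V).

Lemma coords_sum_delta v :
  v = \sum_p v p.1 p.2 *: (delta_mx p.1 p.2 : V).
Proof.
rewrite [LHS]matrix_sum_delta.
by rewrite pair_bigA.
Qed.

Lemma diff_partial f y v : differentiable f y ->
  'd f y v = \sum_p v p.1 p.2 * partial p f y.
Proof.
move=> df; rewrite {1}[v]coords_sum_delta linear_sum; apply: eq_bigr => p _.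
by rewrite linearZ /partial deriveE.
Qed.

(** Formulas [g] for the partial derivatives near [x] make the closure properties computations.
    Differentiability of the partials at the single point [x] is enough for a second-order expansion
    with remainder o(|v|^2). *)
Definition twice_diff f x := exists g : 'I_n.+2 * 'I_n.+2 -> V -> R,
  (\forall y \near x, differentiable f y /\ forall p, partial p f y = g p y) /\
  forall p, differentiable (g p) x.

Lemma twice_diffW f x : twice_diff f x -> differentiable f x.
Proof. by move=> [g [/nbhs_singleton[]]]. Qed.

Lemma twice_diff_cst (a : R) x : twice_diff (fun=> a) x.
Proof.
exists (fun _ _ => 0); split => [|p]; last exact: differentiable_cst.
near=> y; split; first exact: differentiable_cst.
by move=> p; rewrite /partial derive_cst.
Unshelve. all: by end_near. Qed.

Lemma twice_diff_coord i j x : twice_diff (fun y => y i j) x.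
Proof.
exists (fun p _ => (delta_mx p.1 p.2 : V) i j).
split => [|p]; last exact: differentiable_cst.
near=> y; split; first exact: differentiable_coord.
move=> p; rewrite /partial.
have := @derive_mx R V n.+2 n.+2 id y (delta_mx p.1 p.2 : V) (@derivable_id _ _ _ _).
by rewrite derive_id => /matrixP/(_ i j) ->; rewrite mxE.
Unshelve. all: by end_near. Qed.

Lemma twice_diffD f g x : twice_diff f x -> twice_diff g x ->
  twice_diff (fun y => f y + g y) x.
Proof.
move=> [f' [nf df]] [g' [ng dg]].
exists (fun p y => f' p y + g' p y); split => [|p]; last exact: differentiableD.
near=> y.
have [dfy pf] : differentiable f y /\ forall p, partial p f y = f' p y.
  by near: y.
have [dgy pg] : differentiable g y /\ forall p, partial p g y = g' p y.
  by near: y.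
split; first exact: differentiableD.
by move=> p; rewrite -pf -pg; apply: deriveD; exact: diff_derivable.
Unshelve. all: by end_near. Qed.

Lemma twice_diffM f g x : twice_diff f x -> twice_diff g x ->
  twice_diff (fun y => f y * g y) x.
Proof.
move=> tf tg; have dfx := twice_diffW tf; have dgx := twice_diffW tg.
move: tf tg => [f' [nf df]] [g' [ng dg]].
exists (fun p y => f y * g' p y + g y * f' p y); split => [|p]; last first.
  by apply: differentiableD; apply: differentiableM.
near=> y.
have [dfy pf] : differentiable f y /\ forall p, partial p f y = f' p y.
  by near: y.
have [dgy pg] : differentiable g y /\ forall p, partial p g y = g' p y.
  by near: y.
split; first exact: differentiableM.
by move=> p; rewrite -pf -pg; apply: deriveM; exact: diff_derivable.
Unshelve. all: by end_near. Qed.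

Lemma twice_diffZ (a : R) f x : twice_diff f x -> twice_diff (fun y => a * f y) x.
Proof. by apply: twice_diffM; exact: twice_diff_cst. Qed.

Lemma twice_diffN f x : twice_diff f x -> twice_diff (fun y => - f y) x.
Proof.
move=> tf; have -> : (fun y => - f y) = fun y => -1 * f y.
  by apply/funext => y; rewrite mulN1r.
exact: twice_diffZ.
Qed.

Lemma twice_diff_sum (I : Type) (r : seq I) (P : pred I) (F : I -> V -> R) x :
  (forall i, P i -> twice_diff (F i) x) ->
  twice_diff (fun y => \sum_(i <- r | P i) F i y) x.
Proof.
move=> tF; elim: r => [|i r IH].
  have -> : (fun y => \sum_(i <- [::] | P i) F i y) = fun=> 0.
    by apply/funext => y; rewrite big_nil.
  exact: twice_diff_cst.
have -> : (fun y => \sum_(i <- i :: r | P i) F i y) =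
    if P i then fun y => F i y + \sum_(i <- r | P i) F i y
    else fun y => \sum_(i <- r | P i) F i y.
  by case Pi : (P i); apply/funext => y; rewrite big_cons Pi.
by case: ifP => [/tF ti|_] //; exact: twice_diffD.
Qed.

Lemma twice_diff_ln f x : twice_diff f x -> 0 < f x ->
  twice_diff (fun y => ln (f y)) x.
Proof.
move=> tf fx0; have dfx := twice_diffW tf.
move: tf => [f' [nf df]].
exists (fun p y => (f y)^-1 * f' p y); split => [|p]; last first.
  apply: differentiableM => //; apply: differentiableV => //.
  by rewrite gt_eqF.
have fpos : \forall y \near x, 0 < f y.
  by have /cvgr_gt/(_ 0 fx0) := differentiable_continuous dfx.
near=> y.
have [dfy pf] : differentiable f y /\ forall p, partial p f y = f' p y.
  by near: y.
have fy0 : 0 < f y by near: y.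
have [dl dlE] := is_derive1_ln fy0.
have dln : differentiable (@ln R) (f y) by apply/derivable1_diffP.
split; first exact: differentiable_comp.
move=> p; rewrite -pf /partial deriveE; last exact: differentiable_comp.
rewrite (diff_comp dfy dln) /= [in RHS]deriveE // (deriv1E dl).
by rewrite derive1E dlE [LHS]mulrC.
Unshelve. all: by end_near. Qed.

(** A second derivative at [x] depends only on the germ of [partial p f], which may thus be replaced
    by its formula. *)
Lemma hess_quadE f (f' : 'I_n.+2 * 'I_n.+2 -> V -> R) x v :
  (\forall y \near x, forall p, partial p f y = f' p y) ->
  (forall p, differentiable (f' p) x) ->
  hess_quad f x v = \sum_p v p.1 p.2 * 'd (f' p) x v.
Proof.
move=> nf df; apply: eq_bigr => p _.
rewrite diff_partial // mulr_sumr; apply: eq_bigr => q _.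
rewrite -mulrA [v q.1 q.2 * _]mulrC; congr (_ * (_ * _)).
rewrite /hessian /partial; apply: near_eq_derive.
by apply: filterS nf => y; apply.
Qed.

Lemma normr_coord v i j : `|v i j| <= `|v|.
Proof.
by rewrite [leRHS]/Num.Def.normr/= mx_normrE; exact: (le_bigmax _ _ (i, j)).
Qed.

Lemma diff_approx f x (e : R) : differentiable f x -> 0 < e ->
  \forall v \near (0 : V), `|f (x + v) - f x - 'd f x v| <= e * `|v|.
Proof.
move=> df e0; have /eqaddoP/(_ e e0) := diff_locally df.
apply: filterS => v /=.
by rewrite [x + v]addrC -addrA -opprD.
Qed.

Lemma is_derive_line f x v (s : R) : differentiable f (x + s *: v) ->
  is_derive s 1 (fun s : R => f (x + s *: v)) ('d f (x + s *: v) v).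
Proof.
move=> df; pose l := cst x + ( *:%R^~ v) : R -> V.
have dl : is_diff s l (0 + *:%R^~ v) by apply: is_diffD.
have dfl : differentiable (f \o l) s by apply: differentiable_comp.
apply: DeriveDef; first exact: diff_derivable.
rewrite deriveE // diff_comp //= diff_val.
by rewrite [X in 'd f _ X]/= add0r scale1r.
Qed.

Lemma taylor2 f x (e : R) : twice_diff f x -> 0 < e ->
  \forall v \near (0 : V),
    `|f (x + v) - f x - 'd f x v - hess_quad f x v / 2| <= e * `|v| ^+ 2.
Proof.
move=> [g [nf dg]] e0.
(* The remainders of the [m] partial derivatives will be summed, so each is allowed only e / m. *)
pose m : R := #|{: 'I_n.+2 * 'I_n.+2}|%:R.
have m0 : 0 < m by rewrite ltr0n; apply/card_gt0P; exists (ord0, ord0).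
pose e' := e / m; have e'0 : 0 < e' by rewrite divr_gt0.
have ng : \forall v \near (0 : V), forall p,
    `|g p (x + v) - g p x - 'd (g p) x v| <= e' * `|v|.
  apply: (filter_forall (nbhs_filter (0 : V))) => p; exact: diff_approx.
have /nbhs_normP[r r0 rP] := nf.
have /nbhs_normP[r' r'0 r'P] := ng.
have gx p : g p x = partial p f x by have [_ ->] := nbhs_singleton nf.
have nf' : \forall y \near x, forall p, partial p f y = g p y.
  by apply: filterS nf => y [].
have hq := hess_quadE _ nf' dg.
have dfx := (nbhs_singleton nf).1.
apply/nbhs_normP; exists (Num.min r r'); first by rewrite /= lt_min r0.
move=> v /=; rewrite sub0r normrN lt_min => /andP[vr vr'].
have small (s : R) : 0 <= s <= 1 -> `|s *: v| <= `|v|.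
  move=> /andP[s0 s1]; rewrite normrZ ger0_norm //.
  exact: ler_piMl.
have near1 (s : R) : 0 <= s <= 1 ->
    differentiable f (x + s *: v) /\ forall p, partial p f (x + s *: v) = g p (x + s *: v).
  move=> s01; apply: rP; rewrite /= opprD addrA subrr sub0r normrN.
  exact: le_lt_trans (small _ s01) vr.
pose a := 'd f x v; pose q := hess_quad f x v / 2.
(* With the linear and quadratic terms removed, the derivative [dpsi] consists of first-order
   remainders of the partials, weighted by the coordinates of [v]. The mean value theorem on [0, 1]
   then gives the estimate. *)
pose psi : R -> R := (fun s => f (x + s *: v)) - a *: id - q *: (id ^+ 2).
pose dpsi (s : R) := \sum_p v p.1 p.2 *
  (g p (x + s *: v) - g p x - 'd (g p) x (s *: v)).
have dpsiE (s : R) : 0 <= s <= 1 ->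
    dpsi s = 'd f (x + s *: v) v - a * 1 - q * (2 * s).
  move=> s01; have [dfs ps] := near1 _ s01.
  rewrite mulr1 /dpsi.
  rewrite (eq_bigr (fun p => v p.1 p.2 * g p (x + s *: v) - v p.1 p.2 * g p x
      - v p.1 p.2 * 'd (g p) x (s *: v))); last first.
    by move=> p _; rewrite !mulrBr.
  rewrite !sumrB; congr (_ - _ - _).
  - by rewrite (diff_partial v dfs); apply: eq_bigr => p _; rewrite ps.
  - by rewrite /a (diff_partial v dfx); apply: eq_bigr => p _; rewrite gx.
  - rewrite /q hq mulrA divfK ?pnatr_eq0 // mulr_suml; apply: eq_bigr => p _.
    have -> : 'd (g p) x (s *: v) = s * 'd (g p) x v by exact: linearZ.
    by rewrite -mulrA [_ * s]mulrC.
have dpsiP (s : R) : 0 <= s <= 1 -> is_derive s 1 psi (dpsi s).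
  move=> s01; rewrite dpsiE //.
  have D1 := is_derive_line (near1 _ s01).1.
  have D2 : is_derive s (1 : R) (a *: (@id R)) (a * 1) by exact: is_deriveZ.
  have D3 : is_derive s (1 : R) (q *: (@id R ^+ 2)) (q * (2 * s)).
    have D := is_deriveZ q (is_deriveX 2 (is_derive_id s (1 : R))).
    by apply: (is_derive_eq D); rewrite expr1 [X in q *: X]mulr1.
  exact: is_deriveB (is_deriveB D1 D2) D3.
have [c c01 cE] : exists2 c, c \in `]0, 1[%R & psi 1 - psi 0 = dpsi c * (1 - 0).
  apply: MVT => //.
    by move=> s; rewrite in_itv /= => /andP[s0 s1]; apply: dpsiP; rewrite !ltW.
  by apply: derivable_within_continuous => s; rewrite in_itv /= => /dpsiP[].
have -> : f (x + v) - f x - 'd f x v - hess_quad f x v / 2 = dpsi c.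
  have <- : psi 1 - psi 0 = dpsi c by rewrite cE subr0 mulr1.
  have -> : psi 1 = f (x + v) - a - q.
    by rewrite /psi /= !fctE scale1r expr1n /= ![_ *: _]mulr1.
  have -> : psi 0 = f x.
    by rewrite /psi /= !fctE scale0r addr0 expr0n /= ![_ *: _]mulr0 !subr0.
  by rewrite /a /q; lra.
have c01' : 0 <= c <= 1 by move: c01; rewrite in_itv /= => /andP[? ?]; rewrite !ltW.
apply: le_trans (ler_norm_sum _ _ _) _.
apply: (@le_trans _ _ (\sum_(p : 'I_n.+2 * 'I_n.+2) e' * `|v| ^+ 2)); last first.
  by rewrite sumr_const -[leLHS]mulr_natr -/m mulrAC /e' divfK ?gt_eqF.
apply: ler_sum => p _; rewrite normrM expr2 mulrCA; apply: ler_pM => //.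
  exact: normr_coord.
apply: le_trans (r'P (c *: v) _ p) _.
  by rewrite /= sub0r normrN; apply: le_lt_trans (small _ c01') vr'.
by rewrite ler_pM2l // small.
Qed.

End SecondOrder.

(** * Compactness and the barrier around a constrained minimum *)

Section Barrier.
Variables (R : realType) (n : nat).
Local Notation V := (coords R n).
Implicit Types (f g : V -> R) (x y v : V).

(** Heine-Borel is applied to the unit ball of row vectors, whose image under the continuous map
    [vec_mx] contains the sphere as a closed subset. *)
Lemma unit_sphere_compact : compact [set v : V | `|v| = 1].
Proof.
pose u := fun r : 'rV[R]_(n.+2 * n.+2) => vec_mx r : V.
have uc : continuous u.
  move=> r A /nbhs_ballP[e e0 eA]; apply/nbhs_ballP; exists e => //= r' [_ H].
  by apply: eA; split=> // i j; rewrite !mxE; exact: H.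
have cB : compact (u @` [set r | `|r| <= 1]).
  apply: continuous_compact; first exact: continuous_subspaceT.
  apply: bounded_closed_compact.
    by exists 1; split => // M M1 r /= r1; rewrite (le_trans r1) // ltW.
  have -> : [set r : 'rV[R]_(n.+2 * n.+2) | `|r| <= 1] =
      Num.Def.normr @^-1` [set s : R | s <= 1] by [].
  by apply: preimage_closed => [r _|]; [exact: norm_continuous|exact: closed_le].
apply: subclosed_compact cB _.
  have -> : [set v : V | `|v| = 1] = Num.Def.normr @^-1` [set s : R | s = 1] by [].
  by apply: preimage_closed => [r _|]; [exact: norm_continuous|exact: closed_eq].
move=> v /= v1; exists (mxvec v); last by rewrite /u mxvecK.
rewrite /= -v1 [leLHS]/Num.Def.normr/= mx_normrE.
apply/bigmax_leP; split => // -[i k] _ /=; rewrite ord1.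
by case/mxvec_indexP: k => i' j'; rewrite mxvecE normr_coord.
Qed.

Lemma hess_quadZ f x (a : R) v : hess_quad f x (a *: v) = a ^+ 2 * hess_quad f x v.
Proof.
rewrite /hess_quad mulr_sumr; apply: eq_bigr => p _.
rewrite mulr_sumr; apply: eq_bigr => q _; rewrite !mxE; ring.
Qed.

Lemma hess_quad_continuous f x : continuous (hess_quad f x).
Proof.
move=> v; apply: differentiable_continuous; apply: twice_diffW.
apply: twice_diff_sum => p _; apply: twice_diff_sum => q _.
apply: twice_diffM; last exact: twice_diff_coord.
by apply: twice_diffM; [exact: twice_diff_coord|exact: twice_diff_cst].
Qed.

(* By compactness of the unit sphere, the
   Hessian dominates near the joint kernel of the differentials of the [G i],
   and away from it some [G i] has to move at first order. *)
Lemma constrained_hessian_barrier (I : finType) (G : I -> V -> R) f x :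
  twice_diff f x -> (forall v, 'd f x v = 0) ->
  (forall i, differentiable (G i) x) ->
  (forall v, v != 0 -> (forall i, 'd (G i) x v = 0) -> 0 < hess_quad f x v) ->
  exists2 e : R, 0 < e & \forall v \near (0 : V),
    e * `|v| ^+ 2 <= f (x + v) - f x \/
    exists i, e * `|v| <= `|G i (x + v) - G i x|.
Proof.
move=> tf df0 dG Hpos.
(* Positive at every unit vector: where the sum vanishes, [Hpos] makes the Hessian positive. So the
   minimum [m] over the sphere is positive. *)
pose phi v := Num.max (hess_quad f x v) (\sum_i `|'d (G i) x v|).
have phic : continuous phi.
  have hc := @hess_quad_continuous f x.
  have sc : continuous (fun v => \sum_i `|'d (G i) x v|).
    move=> v; apply: (@cvg_big _ _ _ _ _ _ _ (nbhs v) _ _ _ (nbhs_filter v)).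
      exact: add_continuous.
    by move=> i _; apply: (@cvg_norm _ _ _ (nbhs v)); exact: diff_continuous.
  by move=> v; apply: continuous_max; [exact: hc|exact: sc].
have [c c1 cmin] : exists2 c : V, c \in [set v : V | `|v| = 1] &
    forall t, t \in [set v : V | `|v| = 1] -> phi c <= phi t.
  apply: compact_EVT_min; last exact: continuous_subspaceT.
    exists (const_mx 1); rewrite /= [LHS]/Num.Def.normr/= mx_normrE.
    apply/eqP; rewrite eq_le; apply/andP; split.
      by apply/bigmax_leP; split => // i _; rewrite mxE normr1.
    by apply/bigmax_geP; right; exists (ord0, ord0) => //; rewrite mxE normr1.
  exact: unit_sphere_compact.
pose m := phi c.
have m0 : 0 < m.
  rewrite /m /phi lt_max.
  have [_|s0] := ltP 0 (\sum_i `|'d (G i) x c|); rewrite ?orbT // orbF.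
  apply: Hpos.
    by apply/eqP => c0; move: c1; rewrite inE /= c0 normr0 => /eqP; rewrite eq_sym oner_eq0.
  move=> i; apply/normr0_eq0/eqP; rewrite eq_le normr_ge0 andbT.
  apply: le_trans s0; rewrite (bigD1 i) //= lerDl; exact: sumr_ge0.
(* The successor keeps [N] positive for empty [I] and makes the sum of m / N over [I] strictly
   smaller than [m]. *)
pose N : R := (#|I|.+1)%:R.
have N0 : 0 < N by rewrite ltr0n.
(* If the Hessian is at least [m] on the unit vector, the Taylor term m / 2 minus an error m / 8
   leaves more than m / 8. Otherwise some differential is at least m / N, and half of it survives
   the first-order error. *)
exists (Num.min (m / 8) (m / (2 * N))).
  by rewrite lt_min !divr_gt0 // mulr_gt0.
have nG : \forall v \near (0 : V), forall i,
    `|G i (x + v) - G i x - 'd (G i) x v| <= m / (2 * N) * `|v|.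
  apply: (filter_forall (nbhs_filter (0 : V))) => i; apply: diff_approx => //.
  by rewrite divr_gt0 // mulr_gt0.
have nf : \forall v \near (0 : V),
    `|f (x + v) - f x - 'd f x v - hess_quad f x v / 2| <= m / 8 * `|v| ^+ 2.
  by apply: taylor2 => //; rewrite divr_gt0.
near=> v.
have [->|v0] := eqVneq v 0; first by left; rewrite normr0 expr0n mulr0 addr0 subrr.
have nv0 : 0 < `|v| by rewrite normr_gt0.
pose u := `|v|^-1 *: v.
have vE : v = `|v| *: u by rewrite /u scalerA mulfV ?scale1r ?gt_eqF.
have u1 : `|u| = 1 by rewrite /u normrZ normfV normr_id mulVf ?gt_eqF.
have : m <= phi u by apply: cmin; rewrite inE.
rewrite /phi le_max => /orP[hu|Gu].
  left; have : `|f (x + v) - f x - 'd f x v - hess_quad f x v / 2| <= m / 8 * `|v| ^+ 2.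
    by near: v.
  rewrite df0 subr0 {2}vE hess_quadZ ler_norml => /andP[H _].
  apply: (@le_trans _ _ (m / 8 * `|v| ^+ 2)).
    by rewrite ler_wpM2r ?exprn_ge0 // ge_min lexx.
  have : m * `|v| ^+ 2 <= hess_quad f x u * `|v| ^+ 2.
    by rewrite ler_wpM2r ?exprn_ge0.
  have : 0 <= m * `|v| ^+ 2 by rewrite mulr_ge0 ?exprn_ge0 // ltW.
  move: H; set X := `|v| ^+ 2; set Y := hess_quad f x u; lra.
right; have [i Gi] : exists i, m / N <= `|'d (G i) x u|.
  apply/not_existsP => nGi; suff : m < m by rewrite ltxx.
  apply: (le_lt_trans Gu).
  apply: (@le_lt_trans _ _ (\sum_(i : I) m / N)).
    by apply: ler_sum => i _; have /negP := nGi i; rewrite -ltNge => /ltW.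
  rewrite sumr_const -mulr_natr mulrAC ltr_pdivrMr // ltr_pM2l //.
  by rewrite /N ltr_nat ltnS cardE.
exists i; have : `|G i (x + v) - G i x - 'd (G i) x v| <= m / (2 * N) * `|v|.
  by move: i {Gi}; near: v.
have -> : 'd (G i) x v = `|v| * 'd (G i) x u by rewrite {1}vE; exact: linearZ.
have Gv : m / N * `|v| <= `| `|v| * 'd (G i) x u|.
  by rewrite normrM normr_id mulrC ler_pM2l.
have hN : m / (2 * N) = m / N / 2 by rewrite invfM mulrA mulrAC.
move=> H; apply: (@le_trans _ _ (m / (2 * N) * `|v|)).
  by rewrite ler_wpM2r // ge_min lexx orbT.
have := ler_normB (G i (x + v) - G i x) (G i (x + v) - G i x - `|v| * 'd (G i) x u).
rewrite opprB addrC subrK; move: Gv H; rewrite hN.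
set X := `|v|; set Y := m / N; set Z := `|_ - _|; lra.
Unshelve. all: by end_near. Qed.

End Barrier.

(** * One-variable tools: Gronwall and first exit times *)

Section RealLine.
Variable R : realType.
Implicit Types (phi : R -> R) (T : R).

Lemma is_derive_bigsum (V W : normedModType R) (I : Type) (r : seq I) (P : pred I)
    (F : I -> V -> W) (dF : I -> W) (x v : V) :
  (forall i, P i -> is_derive x v (F i) (dF i)) ->
  is_derive x v (fun y => \sum_(i <- r | P i) F i y) (\sum_(i <- r | P i) dF i).
Proof.
move=> FP; elim: r => [|i r IH].
  rewrite big_nil (_ : (fun y => _) = cst 0); first exact: is_derive_cst.
  by apply/funext => y; rewrite big_nil.
rewrite big_cons (_ : (fun y => _) =
    if P i then F i + (fun y => \sum_(i <- r | P i) F i y)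
    else fun y => \sum_(i <- r | P i) F i y).
  case: ifP => [/FP Fi|_]; last exact: IH.
  exact: (is_deriveD Fi IH).
by apply/funext => y; rewrite big_cons; case: ifP.
Qed.

Lemma constant_of_derive0 phi T : 0 <= T -> {within `[0, T], continuous phi} ->
  (forall t, 0 < t < T -> is_derive t 1 phi 0) -> phi T = phi 0.
Proof.
move=> T0 cphi dphi; apply/eqP; rewrite -subr_eq0; apply/eqP.
have dP : forall t, t \in `]0, T[%R -> is_derive t 1 phi 0.
  by move=> t; rewrite in_itv /= => /dphi.
have [c _ ->] := MVT_segment T0 dP cphi.
by rewrite mul0r.
Qed.

Lemma sum_average (I : finType) (a : I -> R) :
  \sum_i \sum_k (a i + a k) / 2 = #|I|%:R * \sum_i a i.
Proof.
under eq_bigr => i _ do rewrite -mulr_suml big_split /= sumr_const.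
rewrite -mulr_suml big_split /= sumr_const sumrMnl cardT -cardE.
set b := _ *+ _; have -> : (b + b) / 2 = b by lra.
by rewrite /b mulr_natl.
Qed.

(** Gronwall for the sum of squares [S], which is differentiable where the absolute values are not:
    S' <= D S, so S exp(-D t) is nonincreasing from the value 0. *)
Lemma linear_growth_zero (I : finType) (u : I -> R -> R) (C T : R) :
  0 <= T -> 0 <= C ->
  (forall i, {within `[0, T], continuous (u i)}) ->
  (forall i t, 0 < t < T ->
     derivable (u i) t 1 /\ `|'D_1 (u i) t| <= C * \sum_k `|u k t|) ->
  (forall i, u i 0 = 0) -> forall i, u i T = 0.
Proof.
move=> T0 C0 uc du u0.
pose S t := \sum_i u i t ^+ 2.
pose dS t := \sum_i (2 * u i t) * 'D_1 (u i) t.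
pose D := 2 * C * #|I|%:R.
pose h t := S t * expR (- D * t).
(* Cauchy-Schwarz, from ab <= (a^2 + b^2) / 2 for each pair of indices. It is the source of the
   factor #|I| in [D]. *)
have sS t : (\sum_i `|u i t|) ^+ 2 <= #|I|%:R * S t.
  rewrite expr2 big_distrlr /=.
  apply: (@le_trans _ _ (\sum_i \sum_k (u i t ^+ 2 + u k t ^+ 2) / 2)).
    apply: ler_sum => i _; apply: ler_sum => k _.
    rewrite -[u i t ^+ 2]real_normK ?num_real // -[u k t ^+ 2]real_normK ?num_real //.
    have := sqr_ge0 (`|u i t| - `|u k t|).
    set a := `|u i t|; set b := `|u k t|; rewrite sqrrB; lra.
  by rewrite sum_average.
have dSP t : 0 < t < T -> is_derive t 1 S (dS t).
  move=> tT; apply: is_derive_bigsum => i _; have [d _] := du i t tT.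
  have D1 := is_deriveX 2 (derivableP d).
  by apply: (is_derive_eq D1); rewrite expr1.
have hP t : 0 < t < T -> is_derive t 1 h ((dS t - D * S t) * expR (- D * t)).
  move=> tT; have D1 := dSP _ tT.
  have D2 : is_derive t 1 (fun t => expR (- D * t)) (- D * expR (- D * t)).
    have D3 : is_derive t (1 : R) (fun t => - D * t) (- D).
      have := is_deriveZ (- D) (is_derive_id t (1 : R)).
      by move=> D4; apply: (is_derive_eq D4); rewrite [LHS]mulr1.
    have := is_derive1_comp (is_derive_expR _) D3.
    by move=> D4; apply: (is_derive_eq D4); rewrite mulrC.
  have D3 := is_deriveM D1 D2; apply: (is_derive_eq D3).
  have scE (a b : R) : a *: b = a * b by [].
  rewrite !scE; ring.
have Sc : {within `[0, T], continuous S}.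
  move=> t; apply: (@cvg_big _ _ _ _ _ _ _ (nbhs t) _ _ _ (nbhs_filter t)).
    exact: add_continuous.
  by move=> i _; apply: cvgM; exact: uc.
have hc : {within `[0, T], continuous h}.
  move=> t; apply: cvgM; first exact: Sc.
  have : {within `[0, T], continuous (fun t => expR (- D * t))}; last exact.
  apply: continuous_subspaceT => s.
  apply: continuous_comp; last exact: continuous_expR.
  by apply: mulrl_continuous.
have hT : h T <= h 0.
  apply: (@ler0_derive1_le_cc _ h 0 T) => //; rewrite ?in_itv /= ?lexx ?T0 //.
    by move=> t; rewrite in_itv /= => /hP[].
  move=> t; rewrite in_itv /= => tT; rewrite derive1E.
  have [_ ->] := hP t tT.
  rewrite pmulr_lle0 ?expR_gt0 // subr_le0.
  apply: (@le_trans _ _ (2 * C * (\sum_i `|u i t|) ^+ 2)); last first.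
    by rewrite /D -[leRHS]mulrA ler_wpM2l // mulr_ge0.
  apply: le_trans (ler_norm _) _; apply: le_trans (ler_norm_sum _ _ _) _.
  rewrite expr2 mulrA mulr_sumr; apply: ler_sum => i _.
  rewrite !normrM ger0_norm // -!mulrA ler_pM2l // [leRHS]mulrA [leRHS]mulrC ler_wpM2l //.
  by have [_] := du i t tT.
have ST : S T <= 0.
  move: hT; rewrite /h [S 0]big1; last by move=> i _; rewrite u0 expr0n.
  by rewrite mul0r pmulr_lle0 // expR_gt0.
have ui : forall i, u i T ^+ 2 <= 0.
  move=> i; apply: le_trans ST; rewrite /S (bigD1 i) //= lerDl.
  by apply: sumr_ge0 => k _; exact: sqr_ge0.
by move=> i; apply/eqP; rewrite -sqrf_eq0 eq_le ui sqr_ge0.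
Qed.

(** The exit time is the least element of the compact set where phi >= rho; the intermediate value
    theorem excludes a jump above [rho]. *)
Lemma first_exit phi T (rho : R) : 0 <= T -> {within `[0, T], continuous phi} ->
  phi 0 < rho -> rho <= phi T ->
  exists t, [/\ 0 <= t <= T, phi t = rho & forall s, 0 <= s <= t -> phi s <= rho].
Proof.
move=> T0 cphi phi0 phiT.
pose A := `[0, T]%classic `&` phi @^-1` [set s | rho <= s].
(* [phi] is continuous only within [0, T], so the preimage is closed relative to the interval: it is
   the trace of a closed set [B]. *)
have [B cB BA] : exists2 B : set R, closed B &
    B `&` `[0, T]%classic = phi @^-1` [set s | rho <= s] `&` `[0, T]%classic.
  apply/closed_subspaceP.
  by apply: preimage_closed; [move=> t _; exact: cphi|exact: closed_ge].
have cA : compact A.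
  rewrite /A setIC -BA setIC; apply: compact_closedI => //; exact: segment_compact.
have [t tA tmin] : exists2 t, t \in A & forall s, s \in A -> t <= s.
  apply: (compact_EVT_min (f := id)) => //.
    by exists T; split=> //=; rewrite in_itv /= T0 lexx.
  by apply: continuous_subspaceT => x; exact: cvg_id.
move: tA; rewrite inE => -[/=]; rewrite in_itv /= => /andP[t0 tT] phit.
have sub : {within `[0, t], continuous phi}.
  by apply: continuous_subspaceW cphi => s /=; rewrite !in_itv /= => /andP[-> /le_trans->].
have below s : 0 <= s < t -> phi s < rho.
  move=> /andP[s0 st]; rewrite ltNge; apply/negP => rs.
  suff : t <= s by rewrite leNgt st.
  apply: tmin; rewrite inE; split=> //=; rewrite in_itv /= s0 /=.
  by rewrite (le_trans (ltW st)).
have tE : phi t = rho.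
  have [|c] := @IVT R phi 0 t rho t0 sub.
    by rewrite ge_min (ltW phi0) /= le_max phit orbT.
  rewrite in_itv /= => /andP[c0 ct] pc.
  have [ct'|] := ltP c t; first by have := below c; rewrite c0 ct' pc ltxx => /(_ isT).
  by move=> tc; rewrite -pc; congr phi; apply/eqP; rewrite eq_le tc ct.
exists t; split=> //; first by rewrite t0 tT.
move=> s /andP[s0]; rewrite le_eqVlt => /predU1P[->|st]; first by rewrite tE.
by apply/ltW/below; rewrite s0 st.
Qed.

End RealLine.

(** * Hermitian coordinates and 2x2 minors *)

Section Hermitian.
Local Open Scope complex_scope.
Local Notation Re := complex.Re.
Local Notation Im := complex.Im.
Variables (R : realType) (n : nat).
Local Notation V := (coords R n).
Local Notation C := R[i].
Implicit Types (x y v : V) (H : 'M[C]_n.+2).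

Lemma ReD (a b : C) : Re (a + b) = Re a + Re b. Proof. by case: a b => [? ?] []. Qed.
Lemma ImD (a b : C) : Im (a + b) = Im a + Im b. Proof. by case: a b => [? ?] []. Qed.
Lemma ReN (a : C) : Re (- a) = - Re a. Proof. by case: a. Qed.
Lemma ImN (a : C) : Im (- a) = - Im a. Proof. by case: a. Qed.
Lemma ReM (a b : C) : Re (a * b) = Re a * Re b - Im a * Im b.
Proof. by case: a b => [? ?] []. Qed.
Lemma ImM (a b : C) : Im (a * b) = Re a * Im b + Im a * Re b.
Proof. by case: a b => [? ?] [? ?] /=; ring. Qed.
Lemma Re_conjc (a : C) : Re (conjc a) = Re a. Proof. by case: a. Qed.
Lemma Im_conjc (a : C) : Im (conjc a) = - Im a. Proof. by case: a. Qed.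
Lemma Re_sum (I : Type) (r : seq I) (P : pred I) (F : I -> C) :
  Re (\sum_(i <- r | P i) F i) = \sum_(i <- r | P i) Re (F i).
Proof. by apply: (big_morph _ ReD). Qed.
Lemma Im_sum (I : Type) (r : seq I) (P : pred I) (F : I -> C) :
  Im (\sum_(i <- r | P i) F i) = \sum_(i <- r | P i) Im (F i).
Proof. by apply: (big_morph _ ImD). Qed.
Lemma complex_ext (a b : C) : Re a = Re b -> Im a = Im b -> a = b.
Proof. by case: a b => [? ?] [? ?] /= -> ->. Qed.

Lemma herm_diag x i : herm x i i = (x i i)%:C.
Proof. by rewrite mxE ltnn. Qed.

Lemma diagcE x i : diagc x i = x i i.
Proof. by rewrite /diagc herm_diag. Qed.

Lemma conjc_herm x i k : conjc (herm x i k) = herm x k i.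
Proof.
by rewrite !mxE; case: ltngtP => [?|?|/val_inj ->]; apply: complex_ext;
  rewrite /= ?opprK ?oppr0.
Qed.

Lemma hermD x y : herm (x + y) = herm x + herm y.
Proof.
by apply/matrixP => i k; rewrite !mxE; case: ltngtP => ?; apply: complex_ext;
  rewrite ?ReD ?ImD /= ?opprD ?addr0.
Qed.

Lemma hermZ (a : R) x : herm (a *: x) = a%:C *: herm x.
Proof.
by apply/matrixP => i k; rewrite !mxE; case: ltngtP => ?; apply: complex_ext;
  rewrite ?ReM ?ImM /= ?mul0r ?mulr0 ?subr0 ?addr0 ?mulrN.
Qed.

Definition unherm H : V :=
  \matrix_(i, k) if (i <= k)%N then Re (H i k) else Im (H k i).

Lemma unhermK H : (forall i k, conjc (H i k) = H k i) -> herm (unherm H) = H.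
Proof.
move=> HH; apply/matrixP => i k; rewrite !mxE.
case: ltngtP => [ik|ki|/val_inj ->].
- by apply: complex_ext.
- rewrite -[RHS]HH; apply: complex_ext; first by rewrite Re_conjc.
  by rewrite Im_conjc.
- have := HH k k; case: (H k k) => a b /= [] bE; rewrite leqnn; congr (_ +i* _).
  lra.
Qed.

Lemma hermK x : unherm (herm x) = x.
Proof.
apply/matrixP => i k; rewrite !mxE.
by case: ltngtP => // /val_inj ->.
Qed.

Definition minor2 H i k i' k' : C := H i k * H i' k' - H i k' * H i' k.

(** As the entries are nonzero, vanishing adjacent minors can be cancelled from column to column,
    which makes consecutive rows proportional; a second induction compares every row with row 0. *)
Lemma adjacent_minors_zero (F : fieldType) (m : nat) (h : nat -> nat -> F) :
  (forall i k, (i <= m)%N -> (k <= m)%N -> h i k != 0) ->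
  (forall i k, (i < m)%N -> (k < m)%N ->
     h i k * h i.+1 k.+1 = h i k.+1 * h i.+1 k) ->
  forall i k, (i <= m)%N -> (k <= m)%N -> h 0%N 0%N * h i k = h 0%N k * h i 0%N.
Proof.
move=> h0 hadj.
have row i : (i < m)%N -> forall k, (k <= m)%N -> h i 0%N * h i.+1 k = h i k * h i.+1 0%N.
  move=> im; elim=> [|k IH] km; first by [].
  have hik := h0 i k (ltnW im) (ltnW km).
  apply: (mulfI hik); have := IH (ltnW km); have := hadj i k im km => E1 E2.
  by rewrite mulrCA E1 mulrCA E2 mulrCA.
elim=> [|i IH] k im km; first by rewrite mulrC.
have hi0 := h0 i 0%N (ltnW im) (leq0n _).
apply: (mulfI hi0); rewrite mulrCA (row i im k km) mulrA (IH k (ltnW im) km).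
by rewrite -mulrA mulrCA.
Qed.

Lemma ringv_neq0 x : ringv x -> forall i k, herm x i k != 0.
Proof.
move=> [d0 o0] i k; case: (ltngtP i k) => [|ki|/val_inj ->]; first exact: o0.
  by rewrite -conjc_herm conjc_eq0; exact: o0.
by rewrite herm_diag; apply/eqP => -[]; apply/eqP; rewrite -diagcE.
Qed.

Lemma FdE i x : (Fd i x)%:C = minor2 (herm x) (lo i) (lo i) (hi i) (hi i).
Proof.
rewrite /Fd /minor2 -[herm x (hi i) (lo i)]conjc_herm !herm_diag !diagcE.
rewrite normCK; case: (herm x (lo i) (hi i)) => a b.
by apply: complex_ext; rewrite /= ?mulr0 ?mul0r ?subr0 ?addr0 //; ring.
Qed.

Lemma FoE (p : upair n) x : Fo p x =
  minor2 (herm x) (lo (val p).1) (lo (val p).2) (hi (val p).1) (hi (val p).2).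
Proof. by rewrite /Fo; case: p => -[i k]. Qed.

(** The minors through the pivot give H_ab = H_a0 H_0b / H_00, an outer product. *)
Lemma minor2_rank1 H : H ord0 ord0 != 0 ->
  (forall i k, minor2 H ord0 ord0 i k = 0) ->
  forall i k i' k', minor2 H i k i' k' = 0.
Proof.
move=> H0 Hm i k i' k'.
have E a b : H a b = H a ord0 * H ord0 b / H ord0 ord0.
  have /eqP := Hm a b; rewrite /minor2 subr_eq0 => /eqP E.
  by rewrite [H a ord0 * _]mulrC -E mulrAC mulfV ?mul1r.
by rewrite /minor2 (E i k) (E i' k') (E i k') (E i' k); ring.
Qed.

(** The components of F are the adjacent minors on and above the diagonal. Conjugation gives those
    below it, and the nonzero entries guaranteed by [ringv] let adjacent minors control all the
    others. *)
Lemma Fzero_minors x : Fzero x <->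
  ringv x /\ forall i k i' k', minor2 (herm x) i k i' k' = 0.
Proof.
split=> [[rx Fd0 Fo0]|[rx m0]]; split=> //; last 2 first.
- by move=> i; have := FdE i x; rewrite m0 => -[].
- by move=> p; rewrite FoE.
have nz := ringv_neq0 rx.
have adj (i k : 'I_n.+1) : minor2 (herm x) (lo i) (lo k) (hi i) (hi k) = 0.
  case: (ltngtP i k) => [ik|ki|/val_inj <-].
  - exact: etrans (esym (FoE (exist _ (i, k) ik) x)) (Fo0 _).
  - have := FoE (exist _ (k, i) ki) x; rewrite Fo0 => /esym/(congr1 conjc).
    rewrite /minor2 rmorph0 rmorphB !rmorphM /= !conjc_herm => E.
    by rewrite -[RHS]E [X in _ - X]mulrC.
  - by rewrite -FdE Fd0.
apply: minor2_rank1 => // i k.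
pose h a b := herm x (inord a) (inord b).
have loE (a : nat) (am : (a < n.+1)%N) : inord a = lo (Ordinal am) :> 'I_n.+2.
  by apply/val_inj; rewrite /= inordK // ltnS ltnW.
have hiE (a : nat) (am : (a < n.+1)%N) : inord a.+1 = hi (Ordinal am) :> 'I_n.+2.
  by apply/val_inj; rewrite /= inordK.
have h1 a b : (a <= n.+1)%N -> (b <= n.+1)%N -> h a b != 0.
  by move=> _ _; exact: nz.
have h2 a b : (a < n.+1)%N -> (b < n.+1)%N -> h a b * h a.+1 b.+1 = h a b.+1 * h a.+1 b.
  by move=> am bm; rewrite /h !(loE _ am) !(loE _ bm) !(hiE _ am) !(hiE _ bm);
    apply/eqP; rewrite -subr_eq0; apply/eqP; exact: adj.
have := adjacent_minors_zero h1 h2 (leq_ord i) (leq_ord k).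
rewrite /h !inord_val; have -> : inord 0 = ord0 :> 'I_n.+2.
  by apply/val_inj; rewrite /= inordK.
by rewrite /minor2 => ->; rewrite subrr.
Qed.

End Hermitian.

(** * Regularity of the Hamiltonian, the Casimirs and the constraints *)

Section ConstraintFunctions.
Local Open Scope complex_scope.
Local Notation Re := complex.Re.
Local Notation Im := complex.Im.
Variables (R : realType) (n : nat).
Local Notation V := (coords R n).
Local Notation C := R[i].
Implicit Types (x y v : V).

Definition ctwice_diff (f : V -> C) x :=
  twice_diff (fun y => Re (f y)) x /\ twice_diff (fun y => Im (f y)) x.

Lemma ctwice_diff_cst (a : C) x : ctwice_diff (fun=> a) x.
Proof. by split; exact: twice_diff_cst. Qed.

Lemma ctwice_diffD f g x : ctwice_diff f x -> ctwice_diff g x ->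
  ctwice_diff (fun y => f y + g y) x.
Proof.
move=> [f1 f2] [g1 g2]; split.
  rewrite (_ : (fun y => _) = fun y => Re (f y) + Re (g y)); first exact: twice_diffD.
  by apply/funext => y; rewrite ReD.
rewrite (_ : (fun y => _) = fun y => Im (f y) + Im (g y)); first exact: twice_diffD.
by apply/funext => y; rewrite ImD.
Qed.

Lemma ctwice_diffM f g x : ctwice_diff f x -> ctwice_diff g x ->
  ctwice_diff (fun y => f y * g y) x.
Proof.
move=> [f1 f2] [g1 g2]; split.
  rewrite (_ : (fun y => _) = fun y => Re (f y) * Re (g y) + - (Im (f y) * Im (g y))).
    by apply: twice_diffD; [|apply: twice_diffN]; exact: twice_diffM.
  by apply/funext => y; rewrite ReM.
rewrite (_ : (fun y => _) = fun y => Re (f y) * Im (g y) + Im (f y) * Re (g y)).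
  by apply: twice_diffD; exact: twice_diffM.
by apply/funext => y; rewrite ImM.
Qed.

Lemma ctwice_diff_sum (I : Type) (r : seq I) (P : pred I) (F : I -> V -> C) x :
  (forall i, P i -> ctwice_diff (F i) x) ->
  ctwice_diff (fun y => \sum_(i <- r | P i) F i y) x.
Proof.
move=> tF; split.
  rewrite (_ : (fun y => _) = fun y => \sum_(i <- r | P i) Re (F i y)).
    by apply: twice_diff_sum => i /tF[].
  by apply/funext => y; rewrite Re_sum.
rewrite (_ : (fun y => _) = fun y => \sum_(i <- r | P i) Im (F i y)).
  by apply: twice_diff_sum => i /tF[].
by apply/funext => y; rewrite Im_sum.
Qed.

Lemma ctwice_diff_herm i k x : ctwice_diff (fun y => herm y i k) x.
Proof.
have E : (fun y : V => herm y i k) = fun y =>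
    if (i < k)%N then y i k +i* y k i else if (k < i)%N then y k i -i* y i k
    else (y i i)%:C by apply/funext => y; rewrite mxE.
rewrite E; case: (i < k)%N; last case: (k < i)%N; split => /=;
  do ?[exact: twice_diff_coord|exact: twice_diff_cst].
by apply: twice_diffN; exact: twice_diff_coord.
Qed.

Lemma ctwice_diff_minor2 i k i' k' x :
  ctwice_diff (fun y => minor2 (herm y) i k i' k') x.
Proof.
have E : (fun y : V => minor2 (herm y) i k i' k') = fun y =>
  herm y i k * herm y i' k' + (- 1) * (herm y i k' * herm y i' k).
  by apply/funext => y; rewrite /minor2 mulN1r.
rewrite E; apply: ctwice_diffD; last apply: ctwice_diffM.
- by apply: ctwice_diffM; exact: ctwice_diff_herm.
- exact: ctwice_diff_cst.
- by apply: ctwice_diffM; exact: ctwice_diff_herm.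
Qed.

Lemma twice_diff_Fo_Re (p : upair n) x : twice_diff (fun y => Re (Fo p y)) x.
Proof.
rewrite (_ : (fun y => _) = fun y => Re (minor2 (herm y) (lo (val p).1)
  (lo (val p).2) (hi (val p).1) (hi (val p).2))); last by apply/funext => y; rewrite FoE.
exact: (ctwice_diff_minor2 _ _ _ _ _).1.
Qed.

Lemma twice_diff_Fo_Im (p : upair n) x : twice_diff (fun y => Im (Fo p y)) x.
Proof.
rewrite (_ : (fun y => _) = fun y => Im (minor2 (herm y) (lo (val p).1)
  (lo (val p).2) (hi (val p).1) (hi (val p).2))); last by apply/funext => y; rewrite FoE.
exact: (ctwice_diff_minor2 _ _ _ _ _).2.
Qed.

Lemma twice_diff_Fd i x : twice_diff (Fd i) x.
Proof.
rewrite (_ : Fd i = fun y => Re (minor2 (herm y) (lo i) (lo i) (hi i) (hi i))).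
  exact: (ctwice_diff_minor2 _ _ _ _ _).1.
by apply/funext => y; rewrite -FdE.
Qed.

Variable Gam : 'I_n.+3 -> R.

Lemma casimir_mxE x : 'i *: (KmxC Gam *m vK_mx x) = - (KmxC Gam *m herm x).
Proof. by rewrite /vK_mx -scalemxAr scalerA -expr2 sqr_i scaleN1r. Qed.

Lemma twice_diff_casimir j x : twice_diff (casimir Gam j) x.
Proof.
have entry i k : ctwice_diff (fun y => ('i *: (KmxC Gam *m vK_mx y)) i k) x.
  rewrite (_ : (fun y => _) = fun y => \sum_l (- KmxC Gam i l) * herm y l k).
    apply: ctwice_diff_sum => l _; apply: ctwice_diffM; first exact: ctwice_diff_cst.
    exact: ctwice_diff_herm.
  apply/funext => y; rewrite casimir_mxE !mxE -sumrN; apply: eq_bigr => l _.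
  by rewrite mulNr.
have pow m : forall i k, ctwice_diff (fun y => (('i *: (KmxC Gam *m vK_mx y)) ^+ m) i k) x.
  elim: m => [|m IH] i k; first by apply: ctwice_diff_cst.
  rewrite (_ : (fun y => _) = fun y => \sum_l ('i *: (KmxC Gam *m vK_mx y)) i l *
      (('i *: (KmxC Gam *m vK_mx y)) ^+ m) l k).
    by apply: ctwice_diff_sum => l _; exact: ctwice_diffM.
  by apply/funext => y; rewrite exprS -mulmxE mxE.
by apply: (ctwice_diff_sum _ (P := xpredT) (fun i _ => pow j i i)).1.
Qed.

Lemma casimir1E x :
  casimir Gam 1 x = - \sum_i \sum_k Kmx Gam i k * Re (herm x k i).
Proof.
rewrite /casimir expr1 casimir_mxE raddfN ReN /=; congr (- _).
rewrite Re_sum; apply: eq_bigr => i _; rewrite mxE Re_sum.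
by apply: eq_bigr => k _; rewrite !mxE ReM /= mul0r subr0.
Qed.

Lemma casimir1D x y : casimir Gam 1 (x + y) = casimir Gam 1 x + casimir Gam 1 y.
Proof.
rewrite !casimir1E -opprD -big_split; congr (- _); apply: eq_bigr => i _.
rewrite -big_split; apply: eq_bigr => k _.
by rewrite hermD [(herm x + _) _ _]mxE ReD mulrDr.
Qed.

Lemma casimir1Z (a : R) x : casimir Gam 1 (a *: x) = a * casimir Gam 1 x.
Proof.
rewrite !casimir1E mulrN mulr_sumr; congr (- _); apply: eq_bigr => i _.
rewrite mulr_sumr; apply: eq_bigr => k _.
by rewrite hermZ [(_ *: herm x) _ _]mxE ReM /= mul0r subr0 mulrCA.
Qed.

Lemma Kmx_sym i k : Kmx Gam i k = Kmx Gam k i.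
Proof. by rewrite !mxE eq_sym; case: eqP => [->//|_]; rewrite [Gm _ _ * _]mulrC. Qed.

(** For rank-one Hermitian H, the matrix A = K H satisfies A^2 = (tr A) A. The trace is real,
    because K is real symmetric, so taking [Re] commutes with powers. At j = 0 the trace of the
    identity would be n.+2 and not 1. *)
Lemma casimir_rank1 j x : (0 < j)%N ->
  (forall i k i' k', minor2 (herm x) i k i' k' = 0) ->
  casimir Gam j x = casimir Gam 1 x ^+ j.
Proof.
move=> j0 m0; pose A : 'M[C]_n.+2 := KmxC Gam *m herm x.
have A2 : A *m A = \tr A *: A.
  apply/matrixP => i k; rewrite !mxE /mxtrace mulr_suml; apply: eq_bigr => l _.
  rewrite !mxE big_distrlr exchange_big big_distrlr /=.
  apply: eq_bigr => a _; apply: eq_bigr => b _.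
  have /eqP := m0 b l a k; rewrite /minor2 subr_eq0 => /eqP E.
  by rewrite mulrACA E mulrACA mulrC.
pose B := - A; have B2 : B *m B = \tr B *: B.
  have -> : \tr B = - \tr A by rewrite /B raddfN.
  by rewrite /B mulmxN mulNmx opprK A2 scalerN scaleNr opprK.
have Bpow m : B ^+ m.+1 = (\tr B) ^+ m *: B.
  elim: m => [|m IH]; first by rewrite expr1 expr0 scale1r.
  by rewrite exprS IH -mulmxE -scalemxAr B2 scalerA -exprSr.
have trA : Im (\tr A) = 0.
  have : conjc (\tr A) = \tr A.
    rewrite rmorph_sum /=.
    transitivity (\sum_i \sum_k KmxC Gam i k * herm x i k).
      apply: eq_bigr => i _; rewrite mxE rmorph_sum /=; apply: eq_bigr => k _.
      rewrite rmorphM /= conjc_herm; congr (_ * _).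
      by rewrite [KmxC Gam i k]mxE /= oppr0.
    rewrite exchange_big; apply: eq_bigr => i _; rewrite mxE; apply: eq_bigr => k _.
    by rewrite ![KmxC _ _ _]mxE Kmx_sym.
  by case: (\tr A) => a b /= []; lra.
have Rpow (z : C) m : Im z = 0 -> Re (z ^+ m) = Re z ^+ m /\ Im (z ^+ m) = 0.
  move=> z0; elim: m => [|m [IH1 IH2]]; first by rewrite !expr0.
  by rewrite !exprS ReM ImM IH1 IH2 z0 !mul0r mulr0 subr0 addr0.
case: j j0 => // j _.
rewrite /casimir expr1 casimir_mxE -/A -/B Bpow linearZ /= -exprSr.
by apply: (Rpow _ _ _).1; rewrite /B raddfN /= ImN trA oppr0.
Qed.

Lemma sum_delta (F : 'I_n.+2 -> R) k : \sum_l (l == k)%:R * F l = F k.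
Proof.
rewrite (bigD1 k) //= big1 ?addr0 ?eqxx ?mul1r // => l /negPf ->.
by rewrite mul0r.
Qed.

Lemma KmxC_unit : (forall i, Gam i != 0) -> Gtot Gam != 0 -> KmxC Gam \in unitmx.
Proof.
move=> G0 GT.
have GT' : Gtot Gam = \sum_i Gm Gam i + Gam ord_max by rewrite /Gtot big_ord_recr.
rewrite map_unitmx.
(* K is -diag(Gamma_i) plus the rank-one matrix with entries Gamma_i Gamma_k / Gamma. [B] is its
   inverse by the Sherman-Morrison formula, with denominator 1 - (Gamma - Gamma_N) / Gamma = Gamma_N
   / Gamma. *)
pose B : 'M[R]_n.+2 := \matrix_(i, k) (- (i == k)%:R / Gm Gam i - (Gam ord_max)^-1).
suff KB : Kmx Gam *m B = 1%:M by case/mulmx1_unit: KB.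
have Gm0 i : Gm Gam i != 0 by exact: G0.
apply/matrixP => i k; rewrite !mxE.
rewrite (eq_bigr (fun l => Gm Gam i * Gm Gam l / Gtot Gam * (- (l == k)%:R / Gm Gam l - (Gam ord_max)^-1)
   - (l == i)%:R * (Gm Gam i * (- (l == k)%:R / Gm Gam l - (Gam ord_max)^-1)))); last first.
  move=> l _; rewrite !mxE [l == i]eq_sym; case: eqP => [<-|_].
    by rewrite mul1r; field; rewrite GT G0 Gm0.
  by rewrite mul0r subr0.
rewrite sumrB (sum_delta _ i).
rewrite (eq_bigr (fun l => (l == k)%:R * - (Gm Gam i / Gtot Gam)
   - Gm Gam l * (Gm Gam i / (Gtot Gam * Gam ord_max)))); last first.
  by move=> l _; field; rewrite GT G0 Gm0.
rewrite sumrB (sum_delta (fun=> _) k) -mulr_suml.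
have -> : \sum_i Gm Gam i = Gtot Gam - Gam ord_max by rewrite GT' addrK.
case: eqP => _; by field; rewrite GT G0 Gm0.
Qed.

Lemma twice_diff_ham x : dom x -> twice_diff (ham Gam) x.
Proof.
move=> [d0 p0].
have td i y : twice_diff (fun y : V => diagc y i) y.
  exact: (ctwice_diff_herm _ _ _).1.
apply: twice_diffZ; apply: twice_diffD.
  apply: twice_diffZ; apply: twice_diff_sum => i _; apply: twice_diffZ.
  by apply: twice_diff_ln.
apply: twice_diff_sum => i _; apply: twice_diff_sum => k ik; apply: twice_diffZ.
apply: twice_diff_ln; last exact: p0.
apply: twice_diffD; first by apply: twice_diffD.
by apply: twice_diffN; apply: twice_diffZ; exact: (ctwice_diff_herm _ _ _).1.
Qed.

Lemma twice_diff_lyapf K (j : 'I_K -> nat) a0 a b c d x : dom x ->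
  twice_diff (lyapf Gam j a0 a b c d) x.
Proof.
move=> dx; apply: twice_diffD; first apply: twice_diffD; first apply: twice_diffD.
- by apply: twice_diffZ; exact: twice_diff_ham.
- by apply: twice_diff_sum => k _; apply: twice_diffZ; exact: twice_diff_casimir.
- by apply: twice_diff_sum => i _; apply: twice_diffZ; exact: twice_diff_Fd.
- apply: twice_diff_sum => p _; apply: twice_diffD; apply: twice_diffZ.
    exact: twice_diff_Fo_Re.
  exact: twice_diff_Fo_Im.
Qed.

End ConstraintFunctions.

(** * The vector field: conserved quantities and action on minors *)

Section VectorField.
Local Open Scope complex_scope.
Local Notation Re := complex.Re.
Local Notation Im := complex.Im.
Variables (R : realType) (n : nat).
Local Notation V := (coords R n).
Local Notation C := R[i].
Implicit Types (y v w : V) (x : R -> V).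

Definition is_cderive (t : R) (f : R -> C) (d : C) :=
  is_derive t 1 (fun s => Re (f s)) (Re d) /\ is_derive t 1 (fun s => Im (f s)) (Im d).

Lemma is_cderiveB t f g d e : is_cderive t f d -> is_cderive t g e ->
  is_cderive t (fun s => f s - g s) (d - e).
Proof.
move=> [f1 f2] [g1 g2]; split.
  rewrite (_ : (fun s => _) = (fun s => Re (f s)) - (fun s => Re (g s))).
    by rewrite ReD ReN; exact: is_deriveB.
  by apply/funext => s; rewrite ReD ReN.
rewrite (_ : (fun s => _) = (fun s => Im (f s)) - (fun s => Im (g s))).
  by rewrite ImD ImN; exact: is_deriveB.
by apply/funext => s; rewrite ImD ImN.
Qed.

Lemma is_cderiveM t f g d e : is_cderive t f d -> is_cderive t g e ->
  is_cderive t (fun s => f s * g s) (d * g t + f t * e).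
Proof.
have scE (a b : R) : a *: b = a * b by [].
move=> [f1 f2] [g1 g2]; split.
  rewrite (_ : (fun s => _) = (fun s => Re (f s)) * (fun s => Re (g s))
     - (fun s => Im (f s)) * (fun s => Im (g s))).
    apply: (is_derive_eq (is_deriveB (is_deriveM f1 g1) (is_deriveM f2 g2))).
    by rewrite !scE !ReD !ReM; ring.
  by apply/funext => s; rewrite ReM.
rewrite (_ : (fun s => _) = (fun s => Re (f s)) * (fun s => Im (g s))
   + (fun s => Im (f s)) * (fun s => Re (g s))).
  apply: (is_derive_eq (is_deriveD (is_deriveM f1 g2) (is_deriveM f2 g1))).
  by rewrite !scE !ImD !ImM; ring.
by apply/funext => s; rewrite ImM.
Qed.

Lemma is_derive_coord (t : R) x v i k : is_derive t 1 x v ->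
  is_derive t 1 (fun s => x s i k) (v i k).
Proof.
move=> [dx <-]; apply: DeriveDef; first exact: (derivable_mxP _ _ _).1.
by rewrite derive_mx // mxE.
Qed.

Lemma is_cderive_herm (t : R) x v i k : is_derive t 1 x v ->
  is_cderive t (fun s => herm (x s) i k) (herm v i k).
Proof.
move=> dx; have dc i k := is_derive_coord i k dx.
have E : (fun s => herm (x s) i k) = fun s =>
    if (i < k)%N then x s i k +i* x s k i else if (k < i)%N then x s k i -i* x s i k
    else (x s i i)%:C by apply/funext => s; rewrite mxE.
rewrite E mxE; case: (i < k)%N; last case: (k < i)%N; split => //=.
  exact: (is_deriveN (dc i k)).
exact: is_derive_cst.
Qed.

(** The derivative of [minor2] at [H] in the direction [H']. *)
Definition dminor2 (H H' : 'M[C]_n.+2) i k i' k' : C :=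
  (H' i k * H i' k' + H i k * H' i' k') - (H' i k' * H i' k + H i k' * H' i' k).

Lemma is_cderive_minor2 (t : R) x v i k i' k' : is_derive t 1 x v ->
  is_cderive t (fun s => minor2 (herm (x s)) i k i' k')
    (dminor2 (herm (x t)) (herm v) i k i' k').
Proof.
by move=> dx; apply: is_cderiveB; apply: is_cderiveM; exact: is_cderive_herm.
Qed.

Lemma is_derive_comp_curve (f : V -> R) (t : R) x v :
  is_derive t 1 x v -> differentiable f (x t) ->
  is_derive t 1 (fun s => f (x s)) ('d f (x t) v).
Proof.
move=> [/[dup] dx /derivable1_diffP dx' <-] df.
apply: DeriveDef; first by apply: diff_derivable; exact: differentiable_comp.
rewrite deriveE; last exact: differentiable_comp.
by rewrite (diff_comp dx' df) /= [in RHS]deriveE.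
Qed.

Lemma is_derive_affine y v : is_derive (0 : R) (1 : R) (fun s : R => y + s *: v) v.
Proof.
have d : is_diff (0 : R) (cst y + ( *:%R^~ v) : R -> V) (0 + *:%R^~ v) by apply: is_diffD.
apply: DeriveDef; first by apply: diff_derivable.
by rewrite deriveE // diff_val [LHS]/= add0r scale1r.
Qed.

Lemma diff_along (f : V -> R) y v (d : R) : differentiable f y ->
  is_derive (0 : R) (1 : R) (fun s : R => f (y + s *: v)) d -> 'd f y v = d.
Proof.
move=> df [_ <-]; have df0 : differentiable f (y + 0 *: v) by rewrite scale0r addr0.
by have [_ ->] := is_derive_line df0; rewrite scale0r addr0.
Qed.

Lemma diff_minor2 y v i k i' k' :
  'd (fun y : V => Re (minor2 (herm y) i k i' k')) y v =
    Re (dminor2 (herm y) (herm v) i k i' k') /\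
  'd (fun y : V => Im (minor2 (herm y) i k i' k')) y v =
    Im (dminor2 (herm y) (herm v) i k i' k').
Proof.
have [tr ti] := ctwice_diff_minor2 i k i' k' y.
have [] := is_cderive_minor2 i k i' k' (is_derive_affine y v).
rewrite scale0r addr0 => dr di.
by split; apply: diff_along => //; exact: twice_diffW.
Qed.

Lemma diff_casimir1 Gam y v : 'd (casimir Gam 1) y v = casimir Gam 1 v.
Proof.
apply: diff_along; first exact/twice_diffW/twice_diff_casimir.
rewrite (_ : (fun s => _) = (cst (casimir Gam 1 y) + casimir Gam 1 v *: id)).
  have D := is_deriveD (is_derive_cst (casimir Gam 1 y) (0 : R) (1 : R))
    (is_deriveZ (casimir Gam 1 v) (is_derive_id (0 : R) (1 : R))).
  by apply: (is_derive_eq D); rewrite add0r [LHS]mulr1.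
by apply/funext => s; rewrite casimir1D casimir1Z mulrC.
Qed.

Lemma vK_mx_vK v : vK (vK_mx v).
Proof. by have [h _ _] := vK_mx_bij R n; exact: h. Qed.

(** An off-diagonal entry occurs twice in the trace and a diagonal one once, so the factor 1/2 of
    the inner product survives only on the diagonal. *)
Lemma vK_inner_coords v w : vK_inner (vK_mx v) (vK_mx w) =
  \sum_p (if p.1 == p.2 then 2^-1 else 1) * (v p.1 p.2 * w p.1 p.2).
Proof.
pose c (i k : 'I_n.+2) : R := if i == k then 2^-1 else 1.
rewrite /vK_inner vK_mx_vK /vK_mx.
have -> : - ('i *: herm v) *m ('i *: herm w) = herm v *m herm w.
  by rewrite mulNmx -scalemxAl -scalemxAr scalerA -expr2 sqr_i scaleN1r opprK.
rewrite Re_sum -(pair_bigA _ (fun i k => c i k * (v i k * w i k))) /=.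
pose e i k := v i k * w i k.
have E i : Re ((herm v *m herm w) i i) = \sum_k c i k * (e i k + e k i).
  rewrite mxE Re_sum; apply: eq_bigr => k _; rewrite !mxE ReM /c /e.
  by case: ltngtP => [ik|ki|/val_inj ->] /=;
    rewrite ?eqxx -?val_eqE ?(ltn_eqF ik) ?(gtn_eqF ki) /=; field.
under eq_bigr do rewrite E.
have -> : \sum_i \sum_k c i k * (e i k + e k i) = 2 * \sum_i \sum_k c i k * e i k.
  transitivity (\sum_i \sum_k c i k * e i k + \sum_i \sum_k c i k * e k i).
    by rewrite -big_split; apply: eq_bigr => i _; rewrite -big_split;
      apply: eq_bigr => k _; rewrite mulrDr.
  rewrite [X in _ + X]exchange_big mulr_natl mulr2n; congr (_ + _).
  by apply: eq_bigr => i _; apply: eq_bigr => k _; rewrite /c eq_sym.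
by rewrite mulKf // pnatr_eq0.
Qed.

Variable Gam : 'I_n.+3 -> R.

Lemma dham_vK_mx y : dom y -> exists2 w, dham Gam y = vK_mx w &
  forall v, vK_inner (vK_mx v) (vK_mx w) = 'D_v (ham Gam) y.
Proof.
move=> dy; have dh := twice_diffW (twice_diff_ham Gam dy).
(* The gradient of [ham]; the 2 cancels the diagonal weight 1/2 of the inner product. *)
pose w0 : V := \matrix_(i, k) ((if i == k then 2 else 1) * partial (i, k) (ham Gam) y).
pose P := [set G | vK G /\ forall v : V, vK_inner (vK_mx v) G = 'D_v (ham Gam) y].
have Pw0 : P (vK_mx w0).
  split; first exact: vK_mx_vK.
  move=> v; rewrite vK_inner_coords deriveE // diff_partial //.
  apply: eq_bigr => -[i k] _ /=; rewrite mxE.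
  by case: eqP => _; [field|rewrite !mul1r].
(* [w0] shows that the set behind [xget] is inhabited, so [dham] meets its specification and does
   not fall back on the default 0. *)
have [vKG PG] : P (dham Gam y) by by apply: xgetPex; exists (vK_mx w0).
have [_ _ surj] := vK_mx_bij R n.
have [w _ wE] := surj _ vKG.
by exists w => [|v]; rewrite wE.
Qed.

(** The modulus on [R[i]] takes values in [R[i]]; this submultiplicative norm is real-valued and
    directly dominates the real and imaginary parts, which are what gets differentiated. *)
Definition norm1 (z : C) : R := `|Re z| + `|Im z|.

Lemma norm1_ge0 z : 0 <= norm1 z. Proof. exact: addr_ge0. Qed.

Lemma norm1D z z' : norm1 (z + z') <= norm1 z + norm1 z'.
Proof.
rewrite /norm1 ReD ImD addrACA; apply: lerD; exact: ler_normD.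
Qed.

Lemma norm1N z : norm1 (- z) = norm1 z.
Proof. by rewrite /norm1 ReN ImN !normrN. Qed.

Lemma norm1M z z' : norm1 (z * z') <= norm1 z * norm1 z'.
Proof.
rewrite /norm1 ReM ImM mulrDl !mulrDr -!normrM.
apply: (le_trans (lerD (ler_normB _ _) (ler_normD _ _))); lra.
Qed.

Lemma norm1_sum (I : Type) (r : seq I) (P : pred I) (F : I -> C) :
  norm1 (\sum_(i <- r | P i) F i) <= \sum_(i <- r | P i) norm1 (F i).
Proof.
elim/big_ind2 : _ => // [|a b c d H1 H2]; first by rewrite /norm1 /= normr0 addr0.
by apply: le_trans (norm1D _ _) _; exact: lerD.
Qed.

(** Testing the defining identity of [dham] on [delta_mx a b] bounds each coordinate by 2 * B, the 2
    coming from the diagonal weight. An entry combines at most two coordinates. *)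
Lemma norm1_dham y (B : R) : dom y ->
  (forall p, `|partial p (ham Gam) y| <= B) ->
  forall i k, norm1 (dham Gam y i k) <= 4 * B.
Proof.
move=> dy pB i k; have [w -> wP] := dham_vK_mx dy.
have B0 : 0 <= B by apply: le_trans (pB (i, k)).
have wB a b : `|w a b| <= 2 * B.
  have := wP (delta_mx a b); rewrite vK_inner_coords.
  rewrite (bigD1 (a, b)) //= big1 ?addr0; last first.
    move=> -[a' b'] /negPf ne; rewrite mxE /=.
    by move: ne; rewrite xpair_eqE => ->; rewrite mul0r mulr0.
  rewrite mxE !eqxx mul1r => E.
  have := pB (a, b); rewrite /partial /= -E normrM.
  have := normr_ge0 (w a b).
  case: eqP => _; rewrite ?normr1 ?mul1r; last by lra.
  by rewrite ger0_norm ?invr_ge0 //; lra.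
rewrite /norm1 /vK_mx mxE ReM ImM /= !mul0r !mul1r sub0r add0r normrN.
rewrite mxE.
have : `|0 : R| <= 2 * B by rewrite normr0; lra.
have := wB i k; have := wB k i; have := wB i i.
case: ltngtP => _ /=; rewrite ?normrN; lra.
Qed.

(** For A = mu, B = K^{-1} and G = dh this is the pairing of the vector field with dh; the two
    products are cyclic permutations of each other. *)
Lemma mxtrace_commutator_zero (m : nat) (A B G : 'M[C]_m) :
  \tr ((- A *m G *m B + B *m G *m A) *m G) = 0.
Proof.
rewrite mulmxDl linearD /= !mulNmx linearN /= -!mulmxA.
rewrite [\tr (B *m _)]mxtrace_mulC -!mulmxA.
by rewrite [\tr (G *m _)]mxtrace_mulC -!mulmxA addNr.
Qed.

Lemma diff_ham_X_h y v : dom y -> vK_mx v = X_h Gam y -> 'd (ham Gam) y v = 0.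
Proof.
move=> dy vX; have dh := twice_diffW (twice_diff_ham Gam dy).
have [w wE wP] := dham_vK_mx dy.
rewrite -deriveE // -wP /vK_inner vK_mx_vK vX /X_h -wE.
rewrite mulNmx linearN /= mxtrace_commutator_zero oppr0 /=.
by rewrite mulr0.
Qed.

(** C_1 is linear, so its derivative along the flow is its value on the velocity. After
    multiplication by K the two terms of [X_h] have opposite traces. *)
Lemma casimir1_X_h y v : KmxC Gam \in unitmx -> vK_mx v = X_h Gam y ->
  casimir Gam 1 v = 0.
Proof.
move=> Ku vX; rewrite /casimir expr1 vX /X_h linearZ /= mulmxDr linearD /=.
rewrite mxtrace_mulC mulNmx -!mulmxA mulVmx // mulmx1.
rewrite [_ *m (invmx _ *m _)]mulmxA mulmxV // mul1mx.
by rewrite linearN /= mxtrace_mulC addNr mulr0.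
Qed.

Lemma herm_X_h y v : vK_mx v = X_h Gam y ->
  herm v = (invmx (KmxC Gam) *m dham Gam y) *m herm y
           + herm y *m (- (dham Gam y *m invmx (KmxC Gam))).
Proof.
have iu : ('i : C) != 0 by rewrite eq_complex /= oner_eq0 andbF.
move=> vX; apply: (scalerI iu); rewrite -/(vK_mx v) vX /X_h scalerDr addrC.
by rewrite /vK_mx -!scalemxAr -scaleNr -!scalemxAl !mulmxN scaleNr scalerN !mulmxA.
Qed.

(** A minor is linear in each of its rows and columns. [Y] replaces a row by a combination of rows
    and [Z] a column by a combination of columns, so only minors of [H] appear. *)
Lemma dminor2_mulmx (H Y Z : 'M[C]_n.+2) i k i' k' :
  dminor2 H (Y *m H + H *m Z) i k i' k' =
  \sum_a (Y i a * minor2 H a k i' k' + Y i' a * minor2 H i k a k'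
    + minor2 H i a i' k' * Z a k + minor2 H i k i' a * Z a k').
Proof.
rewrite /dminor2 !mxE !mulrDl !mulrDr !big_distrl !big_distrr /=.
rewrite -!big_split -sumrB; apply: eq_bigr => a _ /=.
rewrite /minor2; ring.
Qed.

(** Each of the n.+2 summation indices contributes four products, each at most B times the sum over
    all minors. *)
Lemma norm1_dminor2_le (H Y Z : 'M[C]_n.+2) (B : R) i k i' k' :
  (forall a b, norm1 (Y a b) <= B) -> (forall a b, norm1 (Z a b) <= B) ->
  norm1 (dminor2 H (Y *m H + H *m Z) i k i' k') <=
  4 * B * n.+2%:R * \sum_(q : 'I_n.+2 * 'I_n.+2 * ('I_n.+2 * 'I_n.+2))
    norm1 (minor2 H q.1.1 q.1.2 q.2.1 q.2.2).
Proof.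
move=> YB ZB; set S := \sum_q _; rewrite dminor2_mulmx.
have mS a b a' b' : norm1 (minor2 H a b a' b') <= S.
  rewrite /S (bigD1 ((a, b), (a', b'))) //= lerDl.
  by apply: sumr_ge0 => q _; exact: norm1_ge0.
have B0 : 0 <= B by apply: le_trans (norm1_ge0 _) (YB i i).
apply: le_trans (norm1_sum _ _ _) _.
apply: (@le_trans _ _ (\sum_(a < n.+2) 4 * B * S)); last first.
  by rewrite sumr_const card_ord -[leLHS]mulr_natr [leLHS]mulrAC.
apply: ler_sum => a _.
have bnd z z' : norm1 z <= B -> norm1 z' <= S -> norm1 (z * z') <= B * S.
  by move=> zB zS; apply: le_trans (norm1M _ _) _; apply: ler_pM => //; exact: norm1_ge0.
have E1 := bnd _ _ (YB i a) (mS a k i' k').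
have E2 := bnd _ _ (YB i' a) (mS i k a k').
have E3 := bnd _ _ (ZB a k) (mS i a i' k').
have E4 := bnd _ _ (ZB a k') (mS i k i' a).
rewrite [minor2 H i a i' k' * _]mulrC [minor2 H i k i' a * _]mulrC.
apply: le_trans (norm1D _ _) _.
apply: le_trans (lerD (norm1D _ _) (lexx _)) _.
apply: le_trans (lerD (lerD (norm1D _ _) (lexx _)) (lexx _)) _.
lra.
Qed.

End VectorField.

(** * Calculus of C^1 curves *)

Section C1Curves.
Variables (R : realType) (W : normedModType R).

(** A formula [g] for the derivative near [t] gives closure under the algebraic operations;
    [C1_at_derive1] returns to the form that [tangent] asks for. *)
Definition C1_at (U : normedModType R) (f : R -> U) (t : R) :=
  exists2 g : R -> U, (\forall s \near t, is_derive s (1 : R) f (g s)) & {for t, continuous g}.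

Lemma is_deriveZl (k : R -> R) (t dk : R) (P : W) :
  is_derive t 1 k dk -> is_derive t 1 (fun s => k s *: P) (dk *: P).
Proof.
move=> [/derivable1_diffP dk' <-].
have d : differentiable (fun s => k s *: P) t by exact: differentiableZl.
apply: DeriveDef; first exact: diff_derivable.
by rewrite deriveE // diffZl // deriveE.
Qed.

Lemma C1_at_cst (U : normedModType R) (P : U) t : C1_at (fun=> P) t.
Proof.
exists (fun=> 0); last exact: cst_continuous.
by near=> s; exact: is_derive_cst.
Unshelve. all: by end_near. Qed.

Lemma C1_at_id t : C1_at (fun s : R => s) t.
Proof.
exists (fun=> 1); last exact: cst_continuous.
by near=> s; exact: is_derive_id.
Unshelve. all: by end_near. Qed.

Lemma C1_atD (U : normedModType R) (f g : R -> U) t : C1_at f t -> C1_at g t ->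
  C1_at (fun s => f s + g s) t.
Proof.
move=> [f' nf cf] [g' ng cg]; exists (fun s => f' s + g' s); last exact: cvgD.
near=> s.
have df : is_derive s 1 f (f' s) by near: s.
have dg : is_derive s 1 g (g' s) by near: s.
exact: (is_deriveD df dg).
Unshelve. all: by end_near. Qed.

Lemma C1_at_continuous (f : R -> R) t : C1_at f t -> {for t, continuous f}.
Proof.
move=> [f' nf _]; have [df _] := nbhs_singleton nf.
by apply: differentiable_continuous; apply/derivable1_diffP.
Qed.

Lemma C1_atM (f g : R -> R) t : C1_at f t -> C1_at g t ->
  C1_at (fun s => f s * g s) t.
Proof.
move=> Cf Cg; have cf := C1_at_continuous Cf; have cg := C1_at_continuous Cg.
move: Cf Cg => [f' nf cf'] [g' ng cg'].
exists (fun s => f s * g' s + g s * f' s); last by apply: cvgD; exact: cvgM.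
near=> s.
have df : is_derive s 1 f (f' s) by near: s.
have dg : is_derive s 1 g (g' s) by near: s.
exact: (is_deriveM df dg).
Unshelve. all: by end_near. Qed.

Lemma is_derive_inv (f : R -> R) (t d : R) : f t != 0 -> is_derive t 1 f d ->
  is_derive t 1 (fun s => (f s)^-1) (- (f t)^-2 * d).
Proof.
move=> ft [df <-]; apply: DeriveDef; first exact: derivableV.
exact: deriveV.
Qed.

Lemma C1_atV (f : R -> R) t : f t != 0 -> C1_at f t -> C1_at (fun s => (f s)^-1) t.
Proof.
move=> ft Cf; have cf := C1_at_continuous Cf; move: Cf => [f' nf cf'].
have nz : \forall s \near t, f s != 0 by exact: (cvgr_neq0 _ cf ft).
exists (fun s => - (f s)^-2 * f' s).
  near=> s; apply: is_derive_inv; first by near: s.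
  by near: s.
apply: cvgM => //; apply: cvgN; apply: cvgV; first by rewrite expf_neq0.
exact: cvgM.
Unshelve. all: by end_near. Qed.

Lemma C1_atZl (k : R -> R) (P : W) t : C1_at k t -> C1_at (fun s => k s *: P) t.
Proof.
move=> [k' nk ck]; exists (fun s => k' s *: P); last exact: cvgZr_tmp.
near=> s; apply: is_deriveZl; by near: s.
Unshelve. all: by end_near. Qed.

Lemma C1_at_derive1 (f : R -> W) t : C1_at f t ->
  derivable f t 1 /\ {for t, continuous (derive1 f)}.
Proof.
move=> [g ng cg]; split; first by have [] := nbhs_singleton ng.
have E : \forall s \near t, g s = derive1 f s.
  near=> s; have [_ <-] : is_derive s 1 f (g s) by near: s.
  by rewrite derive1E.
move: cg; rewrite /prop_for /continuous_at (nbhs_singleton E : g t = _) => cg.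
by apply: (cvg_trans _ cg); exact: near_eq_cvg.
Unshelve. all: by end_near. Qed.

End C1Curves.

(** * Rank-one Hermitian matrices *)

Section RankOneCurves.
Local Open Scope complex_scope.
Local Notation Re := complex.Re.
Local Notation Im := complex.Im.
Variables (R : realType) (n : nat).
Local Notation V := (coords R n).
Local Notation C := R[i].
Local Notation vec := 'cV[C]_n.+2.
Implicit Types (x y v : V) (z w : vec).

Lemma ringv_near x : ringv x -> \forall y \near x, ringv y.
Proof.
move=> rx; have nz := ringv_neq0 rx.
have : \forall y \near x, forall i k, herm y i k != 0.
  apply: (filter_forall (nbhs_filter x)) => i; apply: (filter_forall (nbhs_filter x)) => k.
  have [/twice_diffW/differentiable_continuous cr /twice_diffW/differentiable_continuous ci] :=
    ctwice_diff_herm i k x.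
  have := nz i k; rewrite eq_complex /= negb_and => /orP[h|h].
    apply: filterS (cvgr_neq0 (FF := nbhs_filter x) _ cr h) => y.
    by rewrite eq_complex negb_and /= => ->.
  apply: filterS (cvgr_neq0 (FF := nbhs_filter x) _ ci h) => y.
  by rewrite eq_complex negb_and /= => ->; rewrite orbT.
apply: filterS => y hy; split=> // i.
by have := hy i i; rewrite herm_diag diagcE; apply: contra_neq => ->.
Qed.

Variable s : R.

(** The matrix s (z w^H + w z^H), a symmetric real-bilinear map. Its diagonal is twice s z z^H, and
    it describes the tangent vectors to the rank-one matrices; [s] may be negative. *)
Definition symouter z w : V :=
  unherm (\matrix_(i, k) (s%:C * (z i 0 * conjc (w k 0) + w i 0 * conjc (z k 0)))).

Lemma herm_symouter z w i k : herm (symouter z w) i k =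
  s%:C * (z i 0 * conjc (w k 0) + w i 0 * conjc (z k 0)).
Proof.
rewrite unhermK ?mxE // => a b; rewrite !mxE !(rmorphM, rmorphD) /= !conjcK oppr0.
by congr (_ * _); rewrite addrC; congr (_ + _); rewrite mulrC.
Qed.

Lemma herm_inj : injective (@herm R n).
Proof. exact: can_inj (@hermK R n). Qed.

Lemma symouterC z w : symouter z w = symouter w z.
Proof.
apply: herm_inj; apply/matrixP => i k; rewrite !herm_symouter.
by congr (_ * _); exact: addrC.
Qed.

Lemma symouterDl z z' w : symouter (z + z') w = symouter z w + symouter z' w.
Proof.
apply: herm_inj; apply/matrixP => i k; rewrite hermD [RHS]mxE !herm_symouter !mxE rmorphD /=.
ring.
Qed.

Lemma symouterDr z w w' : symouter z (w + w') = symouter z w + symouter z w'.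
Proof. by rewrite symouterC symouterDl !(symouterC _ z). Qed.

Lemma symouterZl (a : R) z w : symouter (a%:C *: z) w = a *: symouter z w.
Proof.
apply: herm_inj; apply/matrixP => i k; rewrite hermZ [RHS]mxE !herm_symouter !mxE.
by apply: complex_ext; rewrite !(ReM, ImM, ReD, ImD, Re_conjc, Im_conjc) /=; ring.
Qed.

Lemma symouterZr (a : R) z w : symouter z (a%:C *: w) = a *: symouter z w.
Proof. by rewrite symouterC symouterZl symouterC. Qed.

Definition outer z : V := 2^-1 *: symouter z z.

Lemma herm_outer z i k : herm (outer z) i k = s%:C * (z i 0 * conjc (z k 0)).
Proof.
rewrite hermZ mxE herm_symouter; by apply: complex_ext;
  rewrite !(ReM, ImM, ReD, ImD) /=; field.
Qed.

Lemma minor2_outer z i k i' k' : minor2 (herm (outer z)) i k i' k' = 0.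
Proof. by rewrite /minor2 !herm_outer; ring. Qed.

(** With fixed matrices as coefficients of a polynomial in [l] and [t], regularity of the curve
    reduces to that of scalar functions. *)
Lemma outer_affine (p d w : vec) (l t : R) :
  outer (p + l%:C *: (d + t%:C *: w)) =
    outer p + l *: symouter p d + (l * t) *: symouter p w + (l * l) *: outer d
    + (l * l * t) *: symouter d w + (l * l * (t * t)) *: outer w.
Proof.
rewrite /outer !(symouterDl, symouterDr, symouterZl, symouterZr).
rewrite [symouter d p]symouterC [symouter w p]symouterC [symouter w d]symouterC.
set a := symouter p p; set b := symouter p d; set c := symouter p w.
set e := symouter d d; set f := symouter d w; set g := symouter w w.
by apply/matrixP => i k; rewrite !mxE; field.
Qed.

End RankOneCurves.

(** * Kernel directions are tangent to the constraint set *)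

Section Tangent.
Local Open Scope complex_scope.
Local Notation Re := complex.Re.
Local Notation Im := complex.Im.
Variables (R : realType) (n : nat) (Gam : 'I_n.+3 -> R).
Local Notation V := (coords R n).
Local Notation C := R[i].
Local Notation vec := 'cV[C]_n.+2.
Implicit Types (x y v : V) (z w : vec).

(** The choice w = K u gives the value -2 s |K u|^2, which is nonzero because K is invertible. *)
Lemma casimir1_symouter_nondegenerate (s : R) (u : vec) :
  s != 0 -> u != 0 -> KmxC Gam \in unitmx ->
  exists w, casimir Gam 1 (symouter s u w) != 0.
Proof.
move=> s0 u0 Ku; pose w := KmxC Gam *m u.
have w0 : w != 0 by apply: contra_neq u0 => w0; rewrite -[u](mulKmx Ku) -/w w0 mulmx0.
exists w.
have -> : casimir Gam 1 (symouter s u w) =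
    - (2 * s) * \sum_i (Re (w i 0) ^+ 2 + Im (w i 0) ^+ 2).
  pose T i k := Kmx Gam i k * s * (Re (u i 0) * Re (w k 0) + Im (u i 0) * Im (w k 0)).
  rewrite casimir1E mulNr; congr (- _).
  transitivity (\sum_i \sum_k (T i k + T k i)).
    apply: eq_bigr => i _; apply: eq_bigr => k _; rewrite herm_symouter /T (Kmx_sym _ k i).
    by rewrite !(ReM, ImM, ReD, ImD, Re_conjc, Im_conjc) /=; ring.
  have -> : \sum_i \sum_k (T i k + T k i) = 2 * \sum_k \sum_i T i k.
    under eq_bigr do rewrite big_split /=.
    rewrite big_split /= [X in X + _]exchange_big mulr_natl mulr2n; congr (_ + _).
  rewrite -mulrA; congr (_ * _); rewrite mulr_sumr; apply: eq_bigr => k _.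
  have wr : Re (w k 0) = \sum_i Kmx Gam i k * Re (u i 0).
    rewrite mxE Re_sum; apply: eq_bigr => i _.
    by rewrite mxE ReM /= mul0r subr0 Kmx_sym.
  have wi : Im (w k 0) = \sum_i Kmx Gam i k * Im (u i 0).
    rewrite mxE Im_sum; apply: eq_bigr => i _.
    by rewrite [KmxC _ _ _]mxE ImM /= mul0r addr0 Kmx_sym.
  rewrite !expr2 {1}wr {1}wi !mulr_suml -big_split mulr_sumr.
  by apply: eq_bigr => i _; rewrite /T /=; ring.
rewrite mulf_neq0 ?oppr_eq0 ?mulf_neq0 ?pnatr_eq0 //.
apply: contra w0 => /eqP S0; apply/eqP/matrixP => i k; rewrite ord1 [RHS]mxE.
have : Re (w i 0) ^+ 2 + Im (w i 0) ^+ 2 == 0.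
  have /eqP := S0; rewrite psumr_eq0 => [/allP/(_ i (mem_index_enum _))//|a _].
  by rewrite addr_ge0 ?sqr_ge0.
rewrite paddr_eq0 ?sqr_ge0 // !sqrf_eq0 => /andP[/eqP a /eqP b].
exact: complex_ext.
Qed.

(** [u] is the pivot column and [s] the inverse of the pivot. The pivot minors and their derivatives
    express all entries of [x] and [v] through the row and column of the pivot. *)
Lemma rank1_tangent_vectors x : ringv x ->
  (forall i k, minor2 (herm x) ord0 ord0 i k = 0) ->
  exists s (u : vec), [/\ s != 0, u != 0, x = outer s u &
    forall v, (forall i k, dminor2 (herm x) (herm v) ord0 ord0 i k = 0) ->
      exists w, v = symouter s u w].
Proof.
move=> rx m0.
have x0 : x ord0 ord0 != 0 by have [d _] := rx; rewrite -diagcE.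
have h0 : herm x ord0 ord0 != 0 by exact: ringv_neq0.
exists (x ord0 ord0)^-1, (\col_i herm x i ord0).
set s := _^-1; set u := \col_i _.
have sC : s%:C = (herm x ord0 ord0)^-1 by rewrite herm_diag fmorphV.
have uE i : u i 0 = herm x i ord0 by rewrite mxE.
split; first by rewrite invr_eq0.
- by apply: contra_neq h0 => E; rewrite -uE E mxE.
- apply: herm_inj; apply/matrixP => i k; rewrite herm_outer !uE conjc_herm sC.
  have /eqP := m0 i k; rewrite /minor2 subr_eq0 => /eqP E.
  by rewrite [herm x i ord0 * _]mulrC -E mulKf.
(* Column 0 of [v] alone would count the (0,0) entry twice in [symouter]; subtracting [r] times [u]
   halves that entry of [w]. *)
move=> v dm0; pose r := herm v ord0 ord0 * (2%:R^-1)%:C * s%:C.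
have rr : conjc r = r by rewrite /r !rmorphM /= conjc_herm !oppr0.
exists (\col_i (herm v i ord0 - herm x i ord0 * r)).
apply: herm_inj; apply/matrixP => i k; rewrite herm_symouter !uE.
rewrite [(\col_i _) i 0]mxE [(\col_i _) k 0]mxE.
rewrite rmorphB rmorphM /= !conjc_herm rr.
have /eqP := m0 i k; rewrite /minor2 subr_eq0 => /eqP E.
have Ex : herm x i k = herm x ord0 k * herm x i ord0 / herm x ord0 ord0.
  by rewrite -E mulrAC mulfV ?mul1r.
have := dm0 i k; rewrite /dminor2 Ex => /eqP; rewrite subr_eq0 => /eqP Ev.
apply: (mulfI h0); apply: (addrI (herm v ord0 ord0 *
  (herm x ord0 k * herm x i ord0 / herm x ord0 ord0))).
rewrite Ev /r sC.
have -> : (2%:R^-1)%:C = 2%:R^-1 :> C by rewrite fmorphV rmorph_nat.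
move: h0; set h := herm x ord0 ord0; move: (herm v ord0 ord0) (herm x ord0 k)
  (herm x i ord0) (herm v i ord0) (herm v ord0 k) => a b c d e h0.
by field.
Qed.

(* [p] is the antipode [- u] when the quadric does not contain [0], and an
   isotropic vector otherwise. *)
Lemma quadric_projection_point (s : R) (u : vec) :
  s != 0 -> u != 0 -> KmxC Gam \in unitmx ->
  exists p, casimir Gam 1 (symouter s p p) = casimir Gam 1 (symouter s u u) /\
    casimir Gam 1 (symouter s p u) != casimir Gam 1 (symouter s u u).
Proof.
move=> s0 u0 Ku; pose B z z' := casimir Gam 1 (symouter s z z').
have [u' bu'] := casimir1_symouter_nondegenerate s0 u0 Ku.
have BC z z' : B z z' = B z' z by rewrite /B symouterC.
have BZl (a : R) z z' : B (a%:C *: z) z' = a * B z z' by rewrite /B symouterZl casimir1Z.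
have BZr (a : R) z z' : B z (a%:C *: z') = a * B z z' by rewrite BC BZl BC.
have BDl z z' z'' : B (z + z') z'' = B z z'' + B z' z'' by rewrite /B symouterDl casimir1D.
have BDr z z' z'' : B z (z' + z'') = B z z' + B z z'' by rewrite BC BDl !(BC _ z).
suff : exists p, B p p = B u u /\ B p u != B u u by [].
move: bu'; rewrite -/(B u u').
clearbody B => bu'.
have [c0|c0] := eqVneq (B u u) 0.
  (* As [u] is isotropic here, moving [u'] along it leaves [B u' u] unchanged, and this multiple
     makes the result isotropic too. *)
  exists (u' + (- (B u' u' / (2 * B u u')))%:C *: u).
  rewrite !(BDl, BDr, BZl, BZr) c0 (BC u' u) !mulr0 !addr0; split=> //.
  by move: (B u' u') (B u u') bu' => b1 b2 h; field.
exists ((-1)%:C *: u); rewrite !(BZl, BZr).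
move: (B u u) c0 => b h; split; first by ring.
by apply: contra h => /eqP E; apply/eqP; lra.
Qed.

(* Stereographic projection: the curve is the second intersection of the quadric
   [casimir Gam 1 (outer s z) = const] through [p] with the line from [p] in
   direction [u - p + t w], at parameter [l t]. *)
Lemma tangent_outer K (j : 'I_K -> nat) (s : R) (u w : vec) :
  s != 0 -> u != 0 -> KmxC Gam \in unitmx -> ringv (outer s u) ->
  (forall k, (0 < j k)%N) -> casimir Gam 1 (symouter s u w) = 0 ->
  tangent (Mset Gam j (outer s u)) (outer s u) (symouter s u w).
Proof.
move=> s0 u0 Ku rx j0 cv0.
have [p [qp bp]] := quadric_projection_point s0 u0 Ku.
(* Halved, so that [B z z] is the value of C_1 at [outer s z]. *)
pose B z z' := casimir Gam 1 (symouter s z z') / 2.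
have Bout z : casimir Gam 1 (outer s z) = B z z by rewrite casimir1Z mulrC.
have BS z z' : casimir Gam 1 (symouter s z z') = 2 * B z z' by rewrite /B; field.
have BC z z' : B z z' = B z' z by rewrite /B symouterC.
have BDl z z' z'' : B (z + z') z'' = B z z'' + B z' z''.
  by rewrite /B symouterDl casimir1D mulrDl.
have BDr z z' z'' : B z (z' + z'') = B z z' + B z z'' by rewrite BC BDl !(BC _ z).
have BNl z z' : B (- z) z' = - B z z'.
  have -> : - z = (-1)%:C *: z by rewrite rmorphN1 scaleN1r.
  by rewrite /B symouterZl casimir1Z mulN1r mulNr.
have BNr z z' : B z (- z') = - B z z' by rewrite BC BNl BC.
have Bpp : B p p = B u u by rewrite /B qp.
have Buw : B u w = 0 by rewrite /B cv0 mul0r.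
have Bpu : B p u - B u u != 0.
  by rewrite subr_eq0; apply: contra bp => /eqP E; rewrite !BS E.
clearbody B; pose d := u - p.
(* With q = d + t w, the quadric along p + l q reads B p p + 2 l B p q + l^2 B q q, so the second
   intersection is at l = -2 B p q / B q q. [N] and [D] are -2 B p q and B q q, simplified by B p p
   = B u u and B u w = 0. *)
pose N t : R := -2 * (B p u - B u u + t * B p w); pose D t := N t + t * t * B w w.
pose l t := N t * (D t)^-1.
have N0 : N 0 != 0.
  by rewrite /N mul0r addr0 mulf_neq0 ?oppr_eq0 ?pnatr_eq0.
have D0 : D 0 != 0 by rewrite /D !mul0r addr0.
pose g t : V := outer s (p + (l t)%:C *: (d + t%:C *: w)).
have gE : g = fun t => outer s p + l t *: symouter s p d + (l t * t) *: symouter s p w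
   + (l t * l t) *: outer s d + (l t * l t * t) *: symouter s d w
   + (l t * l t * (t * t)) *: outer s w.
  by apply/funext => t; exact: outer_affine.
have C1N t : C1_at N t.
  apply: C1_atM; first exact: C1_at_cst.
  apply: C1_atD; first exact: C1_at_cst.
  by apply: C1_atM; [exact: C1_at_id|exact: C1_at_cst].
have C1D t : C1_at D t.
  apply: C1_atD; first exact: C1N.
  apply: C1_atM; last exact: C1_at_cst.
  by apply: C1_atM; exact: C1_at_id.
have C1l t : D t != 0 -> C1_at l t.
  by move=> Dt; apply: C1_atM; [exact: C1N|apply: C1_atV].
have C1g t : D t != 0 -> C1_at g t.
  move=> /C1l Cl; have Ci := @C1_at_id R t; rewrite gE.
  have Cll := C1_atM Cl Cl.
  apply: C1_atD; last exact/C1_atZl/C1_atM/C1_atM.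
  apply: C1_atD; last exact/C1_atZl/C1_atM.
  apply: C1_atD; last exact/C1_atZl.
  apply: C1_atD; last exact/C1_atZl/C1_atM.
  apply: C1_atD; last exact/C1_atZl.
  exact: C1_at_cst.
have l0 : l 0 = 1 by rewrite /l /D !mul0r addr0 mulfV.
have g0 : g 0 = outer s u.
  by rewrite /g l0 scale0r addr0 scale1r /d addrC subrK.
have gcas t : D t != 0 -> casimir Gam 1 (g t) = B u u.
  move=> Dt; rewrite gE !(casimir1D, casimir1Z, BS, Bout).
  rewrite /d !(BDl, BDr, BNl, BNr) Bpp Buw (BC u p) /l.
  move: Dt; rewrite /D /N.
  by move: (B p u) (B p w) (B w w) (B u u) => b1 b2 b3 b4 Dt; field.
have dg0 : is_derive (0 : R) (1 : R) g (symouter s u w).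
  have scE (a b : R) : a *: b = a * b by [].
  have did := is_derive_id (0 : R) (1 : R).
  have dcst (a : R) := is_derive_cst a (0 : R) (1 : R).
  have dN : is_derive (0 : R) (1 : R) N (-2 * B p w).
    have := is_deriveM (dcst (-2)) (is_deriveD (dcst (B p u - B u u)) (is_deriveM did (dcst (B p w)))).
    by move=> H; apply: (is_derive_eq H); rewrite !scE /=; ring.
  have dD : is_derive (0 : R) (1 : R) D (-2 * B p w).
    have := is_deriveD dN (is_deriveM (is_deriveM did did) (dcst (B w w))).
    by move=> H; apply: (is_derive_eq H); rewrite !scE /=; ring.
  (* [N] and [D] agree to first order at 0 because B u w = 0. Hence only the term t w contributes to
     the velocity. *)
  have dl : is_derive (0 : R) (1 : R) l 0.
    have H := is_deriveM dN (is_derive_inv D0 dD).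
    apply: (is_derive_eq H); rewrite !scE /= -/(D 0).
    have -> : D 0 = N 0 by rewrite /D !mul0r addr0.
    by move: (N 0) N0 (B p w) => a a0 b; field.
  have dll := is_deriveM dl dl; have dlt := is_deriveM dl did.
  have dllt := is_deriveM dll did; have dlltt := is_deriveM dll (is_deriveM did did).
  have H := is_deriveD (is_deriveD (is_deriveD (is_deriveD (is_deriveD
    (is_derive_cst (outer s p) (0 : R) (1 : R))
    (is_deriveZl (symouter s p d) dl)) (is_deriveZl (symouter s p w) dlt))
    (is_deriveZl (outer s d) dll)) (is_deriveZl (symouter s d w) dllt))
    (is_deriveZl (outer s w) dlltt).
  have ll0 : (l * l) 0 = 1 by rewrite -[LHS]/(l 0 * l 0) l0 mulr1.
  rewrite gE; apply: (is_derive_eq H); rewrite !scE /= ll0 l0.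
  rewrite !(mulr0, mul0r, addr0, add0r, mulr1, mul1r, scale0r, scale1r).
  by rewrite -symouterDl /d addrC subrK.
have gm t : forall i k i' k', minor2 (herm (g t)) i k i' k' = 0.
  by move=> *; exact: minor2_outer.
have xm : forall i k i' k', minor2 (herm (outer s u)) i k i' k' = 0.
  by move=> *; exact: minor2_outer.
(* Far from 0 the denominator may vanish or the curve may leave [ringv]; [tangent] only asks for a
   small interval. *)
have near0 : \forall t \near (0 : R), D t != 0 /\ ringv (g t).
  have cD := C1_at_continuous (C1D 0).
  have [/derivable1_diffP/differentiable_continuous cg _] := C1_at_derive1 (C1g _ D0).
  have n1 : \forall t \near (0 : R), D t != 0 by exact: (cvgr_neq0 _ cD D0).
  have n2 : \forall t \near (0 : R), ringv (g t).
    by apply: cg; rewrite g0; exact: ringv_near.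
  exact: (filterI n1 n2).
have [e e0 eP] := (nbhs_normP _ _).1 near0.
have gt t : `|t| < e -> D t != 0 /\ ringv (g t).
  by move=> te; apply: eP; rewrite /= sub0r normrN.
clearbody g D; exists e, g; split.
- exact: e0.
- exact: g0.
- move=> t /gt[Dt rt]; have [dgt cgt] := C1_at_derive1 (C1g _ Dt).
  split; [|exact: dgt|exact: cgt].
  split; first by apply/Fzero_minors; split.
  by move=> k; rewrite (casimir_rank1 _ (j0 k) (gm t)) (casimir_rank1 _ (j0 k) xm) (gcas t Dt) Bout.
- by rewrite derive1E; case: dg0.
Qed.

Lemma tangent_Mset K (j : 'I_K -> nat) x v :
  KmxC Gam \in unitmx -> Fzero x -> (forall k, (0 < j k)%N) ->
  (forall i k, dminor2 (herm x) (herm v) ord0 ord0 i k = 0) ->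
  casimir Gam 1 v = 0 -> tangent (Mset Gam j x) x v.
Proof.
move=> Ku /Fzero_minors[rx m0] j0 dm0 cv0.
have [s [u [s0 u0 xE tv]]] := rank1_tangent_vectors rx (m0 ord0 ord0).
have [w vE] := tv _ dm0.
by rewrite vE xE; apply: tangent_outer; rewrite -?xE -?vE.
Qed.

End Tangent.

(** * Conservation laws along solutions *)

Section Conservation.
Local Open Scope complex_scope.
Local Notation Re := complex.Re.
Local Notation Im := complex.Im.
Variables (R : realType) (n : nat) (Gam : 'I_n.+3 -> R).
Local Notation V := (coords R n).
Local Notation C := R[i].
Implicit Types (x : R -> V) (y : V) (T : \bar R).

Lemma norm1_mulmx_le (A G : 'M[C]_n.+2) (B : R) (kA := \sum_a \sum_b norm1 (A a b)) :
  (forall a b, norm1 (G a b) <= B) ->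
  (forall a b, norm1 ((A *m G) a b) <= kA * B) /\
  (forall a b, norm1 ((G *m A) a b) <= kA * B).
Proof.
move=> GB; have B0 : 0 <= B := le_trans (norm1_ge0 _) (GB ord0 ord0).
have n1ge0 := @norm1_ge0 R.
have bnd z z' (c : R) : norm1 z' <= c -> norm1 (z * z') <= norm1 z * c.
  by move=> h; apply: le_trans (norm1M _ _) _; rewrite ler_wpM2l.
split=> a b; rewrite mxE; apply: le_trans (norm1_sum _ _ _) _.
  apply: (@le_trans _ _ (\sum_l norm1 (A a l) * B)).
    by apply: ler_sum => l _; exact: bnd.
  rewrite -mulr_suml ler_wpM2r // /kA [leRHS](bigD1 a) //= lerDl.
  by apply: sumr_ge0 => i _; apply: sumr_ge0.
apply: (@le_trans _ _ (\sum_l norm1 (A l b) * B)).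
  by apply: ler_sum => l _; rewrite mulrC; exact: bnd.
rewrite -mulr_suml ler_wpM2r // /kA; apply: ler_sum => l _.
by rewrite [leRHS](bigD1 b) //= lerDl; apply: sumr_ge0.
Qed.

(* Rank one is preserved because the vector field has the form Y mu + mu Z, so
   the derivatives of the 2x2 minors are linear in the 2x2 minors. *)
Lemma solution_conserves T x (t1 B : R) :
  KmxC Gam \in unitmx -> solution Gam T x -> 0 <= t1 -> (t1%:E < T)%E ->
  (forall i k i' k', minor2 (herm (x 0)) i k i' k' = 0) ->
  (forall t, 0 <= t <= t1 -> forall p, `|partial p (ham Gam) (x t)| <= B) ->
  [/\ forall i k i' k', minor2 (herm (x t1)) i k i' k' = 0,
      casimir Gam 1 (x t1) = casimir Gam 1 (x 0) &
      ham Gam (x t1) = ham Gam (x 0)].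
Proof.
move=> Ku [xc xd xs] t10 t1T m0 pB.
have J t : 0 <= t <= t1 -> 0 <= t /\ (t%:E < T)%E.
  by move=> /andP[? tt]; split=> //; apply: le_lt_trans t1T; rewrite lee_fin.
have xc1 : {within `[0, t1], continuous x}.
  by apply: continuous_subspaceW xc => t /=; rewrite in_itv /= => /J.
have comp_c (f : V -> R) : (forall t, 0 <= t <= t1 -> differentiable f (x t)) ->
    {within `[0, t1], continuous (fun t => f (x t))}.
  move=> df; apply: (@within_continuous_comp _ _ _ _ x f _ xc1) => y.
  rewrite inE => -[t /=]; rewrite in_itv /= => tt <-.
  by apply: differentiable_continuous; exact: df.
(* [solution] imposes the equation only for t > 0, so each argument combines continuity on [0, t1]
   with derivatives in the interior. *)
have xder t : 0 < t < t1 -> is_derive t (1 : R) x (derive1 x t) /\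
    vK_mx (derive1 x t) = X_h Gam (x t).
  move=> /andP[t0 tt]; have tJ : 0 <= t <= t1 by rewrite !ltW.
  have [dx xX] := xs t (J t tJ) t0; split; last exact: xX.
  by apply: DeriveDef; [exact: dx|rewrite derive1E].
have dx t : 0 <= t <= t1 -> dom (x t) by move=> /J; exact: xd.
have hd t : 0 <= t <= t1 -> differentiable (ham Gam) (x t).
  by move=> /dx /(twice_diff_ham Gam)/twice_diffW.
have cd t : differentiable (casimir Gam 1) (x t) by exact/twice_diffW/twice_diff_casimir.
have sub t : 0 < t < t1 -> 0 <= t <= t1 by move=> /andP[? ?]; rewrite !ltW.
split; last 2 first.
- apply: (constant_of_derive0 (phi := fun t => casimir Gam 1 (x t)) t10).
    by apply: comp_c => t _; exact: cd.
  move=> t /xder[ddx vX]; have := is_derive_comp_curve ddx (cd t).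
  by rewrite diff_casimir1 (casimir1_X_h Ku vX).
- apply: (constant_of_derive0 (phi := fun t => ham Gam (x t)) t10).
    by apply: comp_c.
  move=> t tt; have [ddx vX] := xder t tt.
  have := is_derive_comp_curve ddx (hd t (sub t tt)).
  by rewrite (diff_ham_X_h (dx t (sub t tt)) vX).
pose Q := ('I_n.+2 * 'I_n.+2 * ('I_n.+2 * 'I_n.+2))%type.
pose m (q : Q) y := minor2 (herm y) q.1.1 q.1.2 q.2.1 q.2.2.
(* Real and imaginary parts of all minors at once: only the full family satisfies a closed linear
   estimate. *)
pose u (qb : Q * bool) (t : R) := if qb.2 then Re (m qb.1 (x t)) else Im (m qb.1 (x t)).
pose Ki := invmx (KmxC Gam); pose kA := \sum_a \sum_b norm1 (Ki a b).
(* 4 * B bounds the entries of [dham] and kA * (4 * B) those of its products with K^{-1}; the other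
   factors come from [norm1_dminor2_le]. *)
pose L := 4 * (kA * (4 * B)) * n.+2%:R.
have B0 : 0 <= B.
  have h : (0 : R) <= 0 <= t1 by apply/andP; split=> //; exact: lexx.
  exact: le_trans (normr_ge0 _) (pB 0 h (ord0, ord0)).
have L0 : 0 <= L.
  rewrite /L !mulr_ge0 //; apply: sumr_ge0 => i _; apply: sumr_ge0 => k _.
  exact: norm1_ge0.
have uc qb : {within `[0, t1], continuous (u qb)}.
  case: qb => q [|]; rewrite /u /=.
    apply: (comp_c (fun y => Re (m q y))) => t _.
    exact/twice_diffW/(ctwice_diff_minor2 _ _ _ _ _).1.
  apply: (comp_c (fun y => Im (m q y))) => t _.
  exact/twice_diffW/(ctwice_diff_minor2 _ _ _ _ _).2.
have ud qb t : 0 < t < t1 -> derivable (u qb) t 1 /\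
    `|'D_1 (u qb) t| <= L * \sum_k `|u k t|.
  move=> tt; have [ddx vX] := xder t tt.
  have GB := norm1_dham (dx t (sub t tt)) (pB t (sub t tt)).
  have [YB ZB] := norm1_mulmx_le Ki GB.
  have ZB' a b : norm1 ((- (dham Gam (x t) *m Ki)) a b) <= kA * (4 * B).
    by rewrite mxE norm1N.
  have sumE : \sum_k `|u k t| = \sum_q norm1 (m q (x t)).
    by rewrite -(pair_bigA _ (fun q b => `|u (q, b) t|)) /=; apply: eq_bigr => q _; rewrite big_bool.
  have {sumE} mb (q : Q) : norm1 (dminor2 (herm (x t)) (herm (derive1 x t)) q.1.1 q.1.2 q.2.1 q.2.2)
      <= L * \sum_k `|u k t|.
    by rewrite sumE (herm_X_h vX); exact: norm1_dminor2_le.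
  case: qb => q b; have mbq := mb q; have [d1 d2] := is_cderive_minor2 q.1.1 q.1.2 q.2.1 q.2.2 ddx.
  move: mbq; rewrite /norm1; set S := \sum_k _ => mbq; case: b; rewrite /u /=.
    case: d1 => d1 ->; split=> //; apply: le_trans mbq; rewrite lerDl; exact: normr_ge0.
  case: d2 => d2 ->; split=> //; apply: le_trans mbq; rewrite lerDr; exact: normr_ge0.
have u0 qb : u qb 0 = 0 by rewrite /u /m m0; case: ifP.
have uz := linear_growth_zero t10 L0 uc ud u0.
move=> i k i' k'; apply: complex_ext; first exact: (uz (((i, k), (i', k')), true)).
exact: (uz (((i, k), (i', k')), false)).
Qed.

Lemma lyapf_Fzero K (j : 'I_K -> nat) (a0 : R) a b c d y :
  (forall k, (0 < j k)%N) -> Fzero y ->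
  lyapf Gam j a0 a b c d y = a0 * ham Gam y + \sum_k a k * casimir Gam 1 y ^+ j k.
Proof.
move=> j0 Fy; have [_ m0] := (Fzero_minors y).1 Fy; case: Fy => _ Fd0 Fo0.
rewrite /lyapf; have -> : \sum_i b i * Fd i y = 0 by apply: big1 => i _; rewrite Fd0 mulr0.
have -> : \sum_p (c p * Re (Fo p y) + d p * Im (Fo p y)) = 0.
  by apply: big1 => p _; rewrite Fo0 !mulr0 addr0.
rewrite !addr0; congr (_ + _); apply: eq_bigr => k _.
by rewrite (casimir_rank1 _ (j0 k) m0).
Qed.

(** Provides the Gronwall constant. The bound is local, since the arguments of the logarithms may
    approach 0 elsewhere. *)
Lemma partial_ham_bounded_near y : dom y ->
  exists B : R, \forall y' \near y, forall p, `|partial p (ham Gam) y'| <= B.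
Proof.
move=> dy; have [g [ng dg]] := twice_diff_ham Gam dy.
exists (\sum_p (`|g p y| + 1)).
have ngb : \forall y' \near y, forall p, `|g p y'| < `|g p y| + 1.
  apply: (filter_forall (nbhs_filter y)) => p.
  have cg := differentiable_continuous (dg p).
  apply: (cvgr_norm_lt (FF := nbhs_filter y) _ cg); rewrite ltrDl; exact: ltr01.
apply: filterS2 ng ngb => y' [_ pE] pB p; rewrite pE.
apply: (le_trans (ltW (pB p))); rewrite [leRHS](bigD1 p) //= lerDl.
by apply: sumr_ge0 => q _; apply: addr_ge0.
Qed.

End Conservation.

(** * Assembly of the stability proof *)

(** The family given to the barrier: C_1 and the minors through the pivot (0,0), the form in which
    [rank1_tangent_vectors] reads the kernel. Trivial members, such as those with i = [ord0], do no
    harm. *)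
Definition stability_constraint (R : realType) (n : nat) (Gam : 'I_n.+3 -> R)
    (q : option ('I_n.+2 * 'I_n.+2 * bool)) (y : coords R n) : R :=
  match q with
  | None => casimir Gam 1 y
  | Some (i, k, true) => complex.Re (minor2 (herm y) ord0 ord0 i k)
  | Some (i, k, false) => complex.Im (minor2 (herm y) ord0 ord0 i k)
  end.

Lemma stability_constraintP (R : realType) (n : nat) (Gam : 'I_n.+3 -> R) (x : coords R n)
    (K : nat) (j : 'I_K -> nat) (G := stability_constraint Gam) :
  KmxC Gam \in unitmx -> Fzero x -> (forall k, (0 < j k)%N) ->
  [/\ forall q, differentiable (G q) x,
      forall v, (forall q, 'd (G q) x v = 0) -> tangent (Mset Gam j x) x v &
      forall y, Fzero y -> forall q, q != None -> G q y = 0].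
Proof.
move=> Ku Fx j0; split.
- move=> [[[i k] b]|]; last exact/twice_diffW/twice_diff_casimir.
  have [hr hi] := ctwice_diff_minor2 ord0 ord0 i k x.
  by case: b; apply: twice_diffW.
- move=> v dG; apply: tangent_Mset => //; last by have := dG None; rewrite diff_casimir1.
  move=> i k; have [dr di] := diff_minor2 x v ord0 ord0 i k.
  apply: complex_ext; [rewrite -dr|rewrite -di].
    exact: (dG (Some (i, k, true))).
  exact: (dG (Some (i, k, false))).
- move=> y /Fzero_minors[_ m0] [[[i k] b]|//] _.
  by rewrite /G /= m0; case: b.
Qed.

Theorem theorem5p2 (R : realType) (n : nat) (Gam : 'I_n.+3 -> R)
  (Gam_neq0 : forall i, Gam i != 0)
  (Gtot_neq0 : Gtot Gam != 0)
  (mu0 : coords R n)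
  (mu0_dom : dom mu0)
  (mu0_F : Fzero mu0)
  (mu0_fixed : X_h Gam mu0 = 0)
  (K : nat) (j : 'I_K -> nat)
  (j_inj : injective j)
  (j_range : forall k, (1 <= j k <= n.+2)%N)
  (indep : independent_at (constraint Gam j) mu0)
  (a0 : R) (a : 'I_K -> R) (b : 'I_n.+1 -> R) (c d : upair n -> R)
  (a0_neq0 : a0 != 0)
  (Df0 : forall v : coords R n, 'd (lyapf Gam j a0 a b c d) mu0 v = 0)
  (Hpos : forall v : coords R n, tangent (Mset Gam j mu0) mu0 v -> v != 0 ->
     0 < hess_quad (lyapf Gam j a0 a b c d) mu0 v) :
  lyapunov_stable_on_Fzero Gam mu0.
Proof.
have Ku := KmxC_unit Gam_neq0 Gtot_neq0.
have j0 k : (0 < j k)%N by have /andP[] := j_range k.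
set f := lyapf Gam j a0 a b c d in Df0 Hpos.
have tf : twice_diff f mu0 by exact: twice_diff_lyapf.
have [dG tG G0] := stability_constraintP Ku mu0_F j0.
set G := stability_constraint Gam in dG tG G0.
have [e e0 barrier] := constrained_hessian_barrier tf Df0 dG
  (fun v v0 dGv => Hpos v (tG v dGv) v0).
have [B pB] := partial_ham_bounded_near Gam mu0_dom.
move=> U UF nU.
have [r r0 rP] : exists2 r : R, 0 < r & forall y, `|y - mu0| < r ->
    [/\ Fzero y -> U y, ringv y, forall p, `|partial p (ham Gam) y| <= B &
        e * `|y - mu0| ^+ 2 <= f y - f mu0 \/
        exists q, e * `|y - mu0| <= `|G q y - G q mu0|].
  have n1 : \forall y \near mu0, (Fzero y -> U y) /\ ringv y.
    have nU' : \forall y \near mu0, Fzero y -> U y by exact: nU.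
    by apply: (filterI nU'); apply: ringv_near; case: mu0_F.
  have [r1 /= r10 r1P] := (nbhs_normP _ _).1 n1.
  have [r2 /= r20 r2P] := (nbhs_normP _ _).1 pB.
  have [r3 /= r30 r3P] := (nbhs_normP _ _).1 barrier.
  exists (Num.min r1 (Num.min r2 r3)); first by rewrite !lt_min r10 r20 r30.
  move=> y; rewrite !lt_min => /and3P[y1 y2 y3].
  have [Uy ry] : (Fzero y -> U y) /\ ringv y by apply: r1P; rewrite /= distrC.
  split=> //; first by apply: r2P; rewrite /= distrC.
  have := r3P (y - mu0); rewrite /= sub0r normrN => /(_ y3).
  by rewrite [mu0 + _]addrC subrK.
(* Half of [r], so that the closed ball of radius [rho] lies where [rP] applies. *)
pose rho := r / 2.
have rho0 : 0 < rho by rewrite divr_gt0.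
have rhor : rho < r by rewrite /rho; lra.
(* The thresholds are the two values of the barrier on the sphere of radius [rho]. *)
pose V := [set y | Fzero y /\ [/\ `|y - mu0| < rho, `|f y - f mu0| < e * rho ^+ 2 &
  `|casimir Gam 1 y - casimir Gam 1 mu0| < e * rho]].
exists V; split.
- by move=> y [Fy [yr _ _]]; have [Uy _ _ _] := rP y (lt_trans yr rhor); exact: Uy.
- have near_lt (h : coords R n -> R) (z : R) : differentiable h mu0 -> 0 < z ->
      \forall y \near mu0, `|h y - h mu0| < z.
    move=> dh z0; have ch := differentiable_continuous dh.
    have := (cvgrPdist_lt (FF := nbhs_filter mu0) _ _).1 ch z z0.
    by apply: filterS => y; rewrite distrC.
  have n1 := near_lt f (e * rho ^+ 2) (twice_diffW tf) (mulr_gt0 e0 (exprn_gt0 _ rho0)).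
  have n2 := near_lt (casimir Gam 1) (e * rho) (dG None) (mulr_gt0 e0 rho0).
  have n3 : \forall y \near mu0, `|y - mu0| < rho.
    apply/nbhs_normP; exists rho => // y /=; by rewrite distrC.
  apply: filterS3 n1 n2 n3 => y y1 y2 y3 Fy; split=> //.
move=> T x T0 xsol [Fx0 [x0r fx0 cx0]].
have [xc _ _] := xsol.
have trapped t1 : 0 <= t1 -> (t1%:E < T)%E ->
    (forall t, 0 <= t <= t1 -> `|x t - mu0| <= rho) ->
    [/\ Fzero (x t1), f (x t1) = f (x 0) &
        casimir Gam 1 (x t1) = casimir Gam 1 (x 0)].
  move=> t10 t1T xr.
  have good t : 0 <= t <= t1 -> `|x t - mu0| < r.
    by move=> /xr xt; exact: le_lt_trans xt rhor.
  have pBx t : 0 <= t <= t1 -> forall p, `|partial p (ham Gam) (x t)| <= B.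
    by move=> /good /rP[].
  have [m1 c1 h1] := solution_conserves Ku xsol t10 t1T ((Fzero_minors _).1 Fx0).2 pBx.
  (* The flow keeps the minors zero, but nonvanishing of the entries is not a conserved quantity: it
     comes from lying in the ball of radius [r]. *)
  have F1 : Fzero (x t1).
    apply/Fzero_minors; split; last exact: m1.
    by have /good /rP[] : 0 <= t1 <= t1 by rewrite t10 lexx.
  split; [exact: F1| |exact: c1].
  by rewrite /f (lyapf_Fzero Gam a0 a b c d j0 F1) (lyapf_Fzero Gam a0 a b c d j0 Fx0) c1 h1.
have inside t1 : 0 <= t1 -> (t1%:E < T)%E -> `|x t1 - mu0| < rho.
  move=> t10 t1T; rewrite ltNge; apply/negP => out.
  have nc : {within `[0, t1], continuous (fun t => `|x t - mu0|)}.
    have xc1 : {within `[0, t1], continuous x}.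
      apply: continuous_subspaceW xc => t /=; rewrite in_itv /= => /andP[t0 tt].
      by split=> //; apply: le_lt_trans t1T; rewrite lee_fin.
    apply: (@within_continuous_comp _ _ _ _ x (fun y => `|y - mu0|) _ xc1) => y _.
    apply: (@cvg_norm _ _ _ (nbhs y)); apply: (@cvgB _ _ _ (nbhs y)).
      exact: cvg_id.
    exact: cvg_cst.
  have [t [/andP[t0 tt] tr ts]] := first_exit t10 nc x0r out.
  have tT : (t%:E < T)%E by apply: le_lt_trans t1T; rewrite lee_fin.
  have [Ft ft ct] := trapped t t0 tT ts.
  have tlr : `|x t - mu0| < r by rewrite tr.
  have [_ _ _ [fb|[q Gb]]] := rP (x t) tlr.
    move: fb; rewrite tr ft leNgt => /negP; apply.
    exact: le_lt_trans (ler_norm _) fx0.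
  (* Only C_1 can move: the other constraints vanish both at [mu0] and at the exit point, so their
     alternative would give e * rho <= 0. *)
  have [qN|qN] := eqVneq q None.
    by move: Gb; rewrite qN tr /= ct leNgt cx0.
  by move: Gb; rewrite (G0 _ Ft _ qN) (G0 _ mu0_F _ qN) subrr normr0 tr leNgt mulr_gt0.
move=> t t0 tT.
have xr s : 0 <= s <= t -> `|x s - mu0| <= rho.
  move=> /andP[s0 st]; apply/ltW/inside => //.
  by apply: le_lt_trans tT; rewrite lee_fin.
have [Ft _ _] := trapped t t0 tT xr.
have [Ut _ _ _] := rP (x t) (lt_trans (inside t t0 tT) rhor).
exact: Ut.
Qed.
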